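(* Let $\lambda\in\mathbb{C}\setminus\{0\}$ and $f_\lambda(z)=\exp(\lambda z)$, with $J(f_\lambda)=\mathbb{C}$. Assume $0\notin X_\lambda$ (i.e. $0$ is non-recurrent). Then: (1) There exists a subsequence $n_k$ such that $(f_\lambda^{n_k})'(1)\to\infty$. (2) If $X_\lambda$ is bounded, then the singular point $z=0$ is summable for $f_\lambda$.
   Context: $f_\lambda^n$ is the $n$-th iterate of $f_\lambda$; $J(f_\lambda)$ is the Julia set, i.e. the complement in $\mathbb{C}$ of the set of points having an open neighbourhood on which $\{f_\lambda^n\}$ is a normal family. The postsingular set is $X_\lambda=\overline{\bigcup_{n\ge1}\{f_\lambda^n(0)\}}$ (note $f_\lambda(0)=1$). A point $a\in\mathbb{C}$ is summable for $f_\lambda$ if the series $\sum_{i\ge0}\frac{1}{(f_\lambda^i)'(a)}$ converges absolutely. *)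

(* Defs.v *)
From Stdlib Require Import Reals.
From Coquelicot Require Import Coquelicot.
Open Scope R_scope.

Definition Cexp (z : C) : C :=
  (exp (Re z) * cos (Im z), exp (Re z) * sin (Im z)).

Definition flam (lam : C) (z : C) : C := Cexp (lam * z)%C.

Definition strictly_increasing (n : nat -> nat) : Prop :=
  forall k : nat, (n k < n (S k))%nat.

Definition closure {T : UniformSpace} (A : T -> Prop) (x : T) : Prop :=
  forall V : T -> Prop, locally x V -> exists y : T, V y /\ A y.

Definition bounded_subset (A : C -> Prop) : Prop :=
  exists M : R, forall z : C, A z -> Cmod z <= M.

(* The Riemann sphere is [option C], with [None] the point at infinity;
   [chordal] is the Euclidean distance under stereographic projection. *)
Definition chordal (p q : option C) : R :=
  match p, q with
  | Some z, Some w =>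
      2 * Cmod (z - w)%C / (sqrt (1 + Cmod z ^ 2) * sqrt (1 + Cmod w ^ 2))
  | Some z, None | None, Some z => 2 / sqrt (1 + Cmod z ^ 2)
  | None, None => 0
  end.

(* Only the values of [g] and [h] on [U] matter. *)
Definition converges_locally_uniformly
    (U : C -> Prop) (g : nat -> C -> C) (h : C -> option C) : Prop :=
  forall z : C, U z ->
    exists V : C -> Prop, locally z V /\
      forall eps : posreal,
        eventually (fun n : nat =>
          forall w : C, U w -> V w -> chordal (Some (g n w)) (h w) < eps).

(* Normality in the sense of Montel: the limit takes values in the sphere, so
   that locally uniform divergence to infinity is allowed. *)
Definition normal_family {I : Type} (U : C -> Prop) (F : I -> C -> C) : Prop :=
  forall m : nat -> I,
    exists (phi : nat -> nat) (h : C -> option C),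
      strictly_increasing phi /\
      converges_locally_uniformly U (fun k => F (m (phi k))) h.

Definition fatou (f : C -> C) (z : C) : Prop :=
  exists U : C -> Prop,
    open U /\ U z /\ normal_family U (fun n : nat => Nat.iter n f).

Definition julia (f : C -> C) (z : C) : Prop := ~ fatou f z.

Definition postsingular (lam : C) : C -> Prop :=
  closure (fun z : C =>
    exists n : nat, (1 <= n)%nat /\ z = Nat.iter n (flam lam) (RtoC 0)).

Definition summable (f : C -> C) (a : C) : Prop :=
  ex_series (fun i : nat => Cmod (/ C_derive (Nat.iter i f) a)%C).

(* Main.v *)
Require Import Defs.
From Stdlib Require Import Reals Lra Lia List ClassicalEpsilon.
From Coquelicot Require Import Coquelicot.
Open Scope R_scope.

(* Every inverse branch of f^n along an orbit staying away from 0 for positive times exists on a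
   disc of a fixed radius rho.  Otherwise a branch h of f^n on a small disc around y, with h(y)
   away from 0, takes the value 0 at some s; glued to the branch along the orbit of 0, which is
   defined around s, it cannot omit a value close to 0, since by a weak Koebe theorem the logarithm
   of the difference with an omitted value varies boundedly between s and y.  So f^n would be
   injective on a fixed disc around 0 and would map it into a small disc; this is impossible for
   large n, since injectivity of all iterates on one disc makes the iterates equicontinuous, and
   for the finitely many other n when the image disc is too small.
   If now the derivatives of f^n along such an orbit stayed bounded, the pulled back discs would
   contain a fixed disc, on which all iterates would be injective, so that the orbit would start in
   the Fatou set.  When the orbit of 0 is bounded, compactness makes this growth uniform, hence
   exponential. *)

(** * Complex differentiability and mean value inequalities *)

(** The orbit of 0 may accumulate anywhere away from 0, so a disc around a point of an admissible
    orbit need not be free of postsingular points, and branches cannot be read off from a simply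
    connected domain missing them. A lift through the exponential needs less: the branch already
    built must not take the value 0. Koebe's bound enters as |h'(z)| d <= 4096 |h(z) - a|, for an
    injective h omitting a on the disc of radius d around z. Inverse branches are injective for
    free, since f^n is a left inverse. The bound is invariant under rescaling, so the radius of the
    disc around 0 on which f^n becomes injective depends only on the distance [del] from 0 to its
    later orbit, neither on n nor on the radius of the branches; this is why rho can be chosen last.
    Normality also rests on Koebe instead of Montel's theorem: iterates of the exponential omit 0,
    so injectivity alone bounds their derivatives. *)

Definition cder (f : C -> C) (z l : C) : Prop :=
  forall eps, 0 < eps -> exists d, 0 < d /\ forall w, Cmod (w - z) < d ->
    Cmod (f w - f z - l * (w - z)) <= eps * Cmod (w - z).

Definition ccont (f : C -> C) (z : C) : Prop :=
  forall eps, 0 < eps -> exists d, 0 < d /\ forall w, Cmod (w - z) < d ->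
    Cmod (f w - f z) < eps.

(** Continuity of the derivative is built in: Cauchy's estimate is obtained by differentiating under
    an integral sign. *)
Definition hol (g g' : C -> C) (z : C) (r : R) : Prop :=
  forall w, Cmod (w - z) < r -> cder g w (g' w) /\ ccont g' w.

Definition rder (c : R -> C) (t : R) (v : C) : Prop :=
  forall eps, 0 < eps -> exists d, 0 < d /\ forall s, Rabs (s - t) < d ->
    Cmod (c s - c t - v * RtoC (s - t)) <= eps * Rabs (s - t).

Lemma Cmod_minus_sym (a b : C) : Cmod (a - b) = Cmod (b - a).
Proof. rewrite <- Cmod_opp. f_equal. ring. Qed.

Lemma Cmod_minus_diag (a : C) : Cmod (a - a) = 0.
Proof. replace (a - a)%C with (RtoC 0) by ring. apply Cmod_0. Qed.

Lemma Cmod_minus_le (a b : C) : Cmod (a - b) <= Cmod a + Cmod b.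
Proof. rewrite <- (Cmod_opp b). apply Cmod_triangle. Qed.

Lemma Cmod_dist_triangle (a b c : C) : Cmod (a - c) <= Cmod (a - b) + Cmod (b - c).
Proof. replace (a - c)%C with ((a - b) + (b - c))%C by ring. apply Cmod_triangle. Qed.

Lemma Cmod_le_dist (a b : C) : Cmod a <= Cmod b + Cmod (a - b).
Proof. replace a with (b + (a - b))%C at 1 by ring. apply Cmod_triangle. Qed.

Lemma Cmod_Re_Im_le (a : C) : Cmod a <= Rabs (Re a) + Rabs (Im a).
Proof.
  destruct a as [x y]; simpl.
  replace (x, y) with (RtoC x + Ci * RtoC y)%C
    by (unfold RtoC, Ci, Cmult, Cplus; simpl; f_equal; ring).
  eapply Rle_trans; [apply Cmod_triangle|].
  rewrite Cmod_mult, !Cmod_R, Cmod_Ci. lra.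
Qed.

Lemma Im_le_Cmod (a : C) : Rabs (Im a) <= Cmod a.
Proof. eapply Rle_trans; [|apply Rmax_Cmod]. apply Rmax_r. Qed.

Lemma Cmod_minus_eq0 (a b : C) : Cmod (a - b) = 0 -> a = b.
Proof.
  intro H. apply Cmod_eq_0 in H.
  replace a with (a - b + b)%C by ring. rewrite H. ring.
Qed.

Lemma cder_ccont f z l : cder f z l -> ccont f z.
Proof.
  intros H eps Heps.
  destruct (H 1 Rlt_0_1) as [d [Hd H1]].
  assert (Hl := Cmod_ge_0 l).
  exists (Rmin d (eps / (2 + Cmod l))). split.
  { apply Rmin_pos; auto. apply Rdiv_lt_0_compat; lra. }
  intros w Hw.
  assert (Hw1 := Rlt_le_trans _ _ _ Hw (Rmin_l _ _)).
  assert (Hw2 := Rlt_le_trans _ _ _ Hw (Rmin_r _ _)).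
  specialize (H1 w Hw1).
  replace (f w - f z)%C with ((f w - f z - l * (w - z)) + l * (w - z))%C by ring.
  eapply Rle_lt_trans; [apply Cmod_triangle|]. rewrite Cmod_mult.
  assert (Cmod (w - z) * (2 + Cmod l) < eps).
  { apply Rlt_le_trans with (eps / (2 + Cmod l) * (2 + Cmod l)).
    - apply Rmult_lt_compat_r; lra.
    - right. field. lra. }
  assert (Hcm := Cmod_ge_0 (w - z)). nra.
Qed.

Lemma cder_ext_ball f g z l r : 0 < r -> (forall w, Cmod (w - z) < r -> f w = g w) ->
  cder f z l -> cder g z l.
Proof.
  intros Hr E H eps Heps. destruct (H eps Heps) as [d [Hd H1]].
  exists (Rmin d r). split. { apply Rmin_pos; auto. }
  intros w Hw.
  assert (Hw1 := Rlt_le_trans _ _ _ Hw (Rmin_l _ _)).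
  assert (Hw2 := Rlt_le_trans _ _ _ Hw (Rmin_r _ _)).
  rewrite <- !E; auto. rewrite Cmod_minus_diag. auto.
Qed.

Lemma cder_const c z : cder (fun _ => c) z (RtoC 0).
Proof.
  intros eps Heps. exists 1. split; [lra|]. intros w _.
  replace (c - c - RtoC 0 * (w - z))%C with (RtoC 0) by ring.
  rewrite Cmod_0. assert (H := Cmod_ge_0 (w - z)). nra.
Qed.

Lemma cder_id z : cder (fun w => w) z (RtoC 1).
Proof.
  intros eps Heps. exists 1. split; [lra|]. intros w _.
  replace (w - z - RtoC 1 * (w - z))%C with (RtoC 0) by ring.
  rewrite Cmod_0. assert (H := Cmod_ge_0 (w - z)). nra.
Qed.

Lemma cder_plus f g z l m : cder f z l -> cder g z m ->
  cder (fun w => f w + g w)%C z (l + m)%C.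
Proof.
  intros Hf Hg eps Heps.
  destruct (Hf (eps/2)) as [d1 [Hd1 H1]]; [lra|].
  destruct (Hg (eps/2)) as [d2 [Hd2 H2]]; [lra|].
  exists (Rmin d1 d2). split. { apply Rmin_pos; auto. }
  intros w Hw.
  specialize (H1 w (Rlt_le_trans _ _ _ Hw (Rmin_l _ _))).
  specialize (H2 w (Rlt_le_trans _ _ _ Hw (Rmin_r _ _))).
  replace (f w + g w - (f z + g z) - (l + m) * (w - z))%C
    with ((f w - f z - l * (w - z)) + (g w - g z - m * (w - z)))%C by ring.
  eapply Rle_trans; [apply Cmod_triangle|]. lra.
Qed.

Lemma cder_scal c f z l : cder f z l -> cder (fun w => c * f w)%C z (c * l)%C.
Proof.
  intros Hf eps Heps. assert (Hc := Cmod_ge_0 c).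
  destruct (Hf (eps / (1 + Cmod c))) as [d1 [Hd1 H1]].
  { apply Rdiv_lt_0_compat; lra. }
  exists d1. split; auto. intros w Hw. specialize (H1 w Hw).
  replace (c * f w - c * f z - c * l * (w - z))%C
    with (c * (f w - f z - l * (w - z)))%C by ring.
  rewrite Cmod_mult. assert (H0 := Cmod_ge_0 (w - z)).
  apply Rle_trans with (Cmod c * (eps / (1 + Cmod c) * Cmod (w - z))).
  { apply Rmult_le_compat_l; auto. }
  replace (Cmod c * (eps / (1 + Cmod c) * Cmod (w - z)))
    with ((Cmod c / (1 + Cmod c)) * (eps * Cmod (w - z))) by (field; lra).
  rewrite <- (Rmult_1_l (eps * Cmod (w - z))) at 2.
  apply Rmult_le_compat_r; [nra|].
  apply Rmult_le_reg_r with (1 + Cmod c); [lra|].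
  unfold Rdiv. rewrite Rmult_assoc, Rinv_l; lra.
Qed.

Lemma cder_minus f g z l m : cder f z l -> cder g z m ->
  cder (fun w => f w - g w)%C z (l - m)%C.
Proof.
  intros Hf Hg.
  assert (H := cder_plus _ _ _ _ _ Hf (cder_scal (RtoC (-1)) _ _ _ Hg)).
  intros eps Heps. destruct (H eps Heps) as [d [Hd H1]]. exists d. split; auto.
  intros w Hw. specialize (H1 w Hw).
  match goal with |- Cmod ?a <= _ => match type of H1 with Cmod ?b <= _ =>
    replace a with b; auto end end.
  apply injective_projections; simpl; ring.
Qed.

(* [inc] is the increment of the variable, so that real curves and complex maps are covered at once. *)
Lemma first_order_comp {T : Type} (inc : T -> C) (c : T -> C) (f : C -> C) (c0 l v : C) :
  cder f c0 l ->
  (forall eps, 0 < eps -> exists d, 0 < d /\ forall s, Cmod (inc s) < d ->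
    Cmod (c s - c0 - v * inc s) <= eps * Cmod (inc s)) ->
  forall eps, 0 < eps -> exists d, 0 < d /\ forall s, Cmod (inc s) < d ->
    Cmod (f (c s) - f c0 - l * v * inc s) <= eps * Cmod (inc s).
Proof.
  intros Hf Hc eps Heps.
  assert (Hl := Cmod_ge_0 l). assert (Hv := Cmod_ge_0 v).
  set (e1 := eps / (2 * (Cmod v + 1))).
  assert (He1 : 0 < e1) by (apply Rdiv_lt_0_compat; lra).
  set (e2 := Rmin 1 (eps / (2 * (Cmod l + 1)))).
  assert (He2 : 0 < e2) by (apply Rmin_pos; [lra|apply Rdiv_lt_0_compat; lra]).
  destruct (Hf e1 He1) as [d1 [Hd1 H1]].
  destruct (Hc e2 He2) as [d2 [Hd2 H2]].
  exists (Rmin d2 (d1 / (Cmod v + 1))). split.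
  { apply Rmin_pos; auto. apply Rdiv_lt_0_compat; lra. }
  intros s Hs.
  assert (Hs1 := Rlt_le_trans _ _ _ Hs (Rmin_l _ _)).
  assert (Hs2 := Rlt_le_trans _ _ _ Hs (Rmin_r _ _)).
  specialize (H2 s Hs1). assert (Ha := Cmod_ge_0 (inc s)).
  assert (Hcs : Cmod (c s - c0) <= (Cmod v + 1) * Cmod (inc s)).
  { replace (c s - c0)%C with ((c s - c0 - v * inc s) + v * inc s)%C by ring.
    eapply Rle_trans; [apply Cmod_triangle|]. rewrite Cmod_mult.
    assert (e2 <= 1) by apply Rmin_l. nra. }
  assert (Hd : Cmod (c s - c0) < d1).
  { eapply Rle_lt_trans; [exact Hcs|].
    apply Rlt_le_trans with ((Cmod v + 1) * (d1 / (Cmod v + 1))).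
    - apply Rmult_lt_compat_l; lra.
    - right; field; lra. }
  specialize (H1 _ Hd).
  replace (f (c s) - f c0 - l * v * inc s)%C
    with ((f (c s) - f c0 - l * (c s - c0)) + l * (c s - c0 - v * inc s))%C by ring.
  eapply Rle_trans; [apply Cmod_triangle|]. rewrite Cmod_mult.
  assert (E1 : e1 * Cmod (c s - c0) <= eps / 2 * Cmod (inc s)).
  { apply Rle_trans with (e1 * ((Cmod v + 1) * Cmod (inc s))).
    - apply Rmult_le_compat_l; lra.
    - right. unfold e1. field. lra. }
  assert (E2 : Cmod l * (e2 * Cmod (inc s)) <= eps / 2 * Cmod (inc s)).
  { rewrite <- Rmult_assoc. apply Rmult_le_compat_r; auto.
    apply Rle_trans with ((Cmod l + 1) * (eps / (2 * (Cmod l + 1)))).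
    - apply Rmult_le_compat; try lra. apply Rmin_r.
    - right. field. lra. }
  assert (Cmod l * Cmod (c s - c0 - v * inc s) <= Cmod l * (e2 * Cmod (inc s)))
    by (apply Rmult_le_compat_l; auto).
  lra.
Qed.

Lemma rder_comp f c t l v : cder f (c t) l -> rder c t v ->
  rder (fun s => f (c s)) t (l * v)%C.
Proof.
  intros Hf Hc eps Heps.
  destruct (first_order_comp (fun s => RtoC (s - t)) c f (c t) l v Hf) with (eps := eps)
    as [d [Hd H]]; auto.
  - intros e He. destruct (Hc e He) as [d [Hd H]]. exists d. split; auto.
    intros s. rewrite Cmod_R. apply H.
  - exists d. split; auto. intros s. specialize (H s). rewrite Cmod_R in H. exact H.
Qed.

Lemma cder_comp f g z l m : cder f (g z) l -> cder g z m ->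
  cder (fun w => f (g w)) z (l * m)%C.
Proof. intros Hf Hg. exact (first_order_comp (fun w => w - z)%C g f (g z) l m Hf Hg). Qed.

Lemma ccont_const c z : ccont (fun _ => c) z.
Proof. exact (cder_ccont _ _ _ (cder_const c z)). Qed.

Lemma ccont_id z : ccont (fun w => w) z.
Proof. exact (cder_ccont _ _ _ (cder_id z)). Qed.

Lemma ccont_comp f g z : ccont f (g z) -> ccont g z -> ccont (fun w => f (g w)) z.
Proof.
  intros Hf Hg eps Heps. destruct (Hf eps Heps) as [d [Hd H]].
  destruct (Hg d Hd) as [d' [Hd' H']]. exists d'. split; auto.
Qed.

Lemma ccont_plus f g z : ccont f z -> ccont g z -> ccont (fun w => f w + g w)%C z.
Proof.
  intros Hf Hg eps Heps.
  destruct (Hf (eps/2)) as [d1 [Hd1 H1]]; [lra|].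
  destruct (Hg (eps/2)) as [d2 [Hd2 H2]]; [lra|].
  exists (Rmin d1 d2). split. { apply Rmin_pos; auto. }
  intros w Hw.
  specialize (H1 w (Rlt_le_trans _ _ _ Hw (Rmin_l _ _))).
  specialize (H2 w (Rlt_le_trans _ _ _ Hw (Rmin_r _ _))).
  replace (f w + g w - (f z + g z))%C with ((f w - f z) + (g w - g z))%C by ring.
  eapply Rle_lt_trans; [apply Cmod_triangle|]. lra.
Qed.

Lemma ccont_mult f g z : ccont f z -> ccont g z -> ccont (fun w => f w * g w)%C z.
Proof.
  intros Hf Hg eps Heps.
  assert (Ha := Cmod_ge_0 (f z)). assert (Hb := Cmod_ge_0 (g z)).
  set (e := Rmin 1 (eps / (2 + Cmod (f z) + Cmod (g z)))).
  assert (He : 0 < e) by (apply Rmin_pos; [lra|apply Rdiv_lt_0_compat; lra]).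
  destruct (Hf e He) as [d1 [Hd1 H1]].
  destruct (Hg e He) as [d2 [Hd2 H2]].
  exists (Rmin d1 d2). split. { apply Rmin_pos; auto. }
  intros w Hw.
  specialize (H1 w (Rlt_le_trans _ _ _ Hw (Rmin_l _ _))).
  specialize (H2 w (Rlt_le_trans _ _ _ Hw (Rmin_r _ _))).
  replace (f w * g w - f z * g z)%C
    with ((f w - f z) * (g w - g z) + ((f w - f z) * g z + f z * (g w - g z)))%C by ring.
  eapply Rle_lt_trans; [apply Cmod_triangle|].
  eapply Rle_lt_trans; [apply Rplus_le_compat_l, Cmod_triangle|].
  rewrite !Cmod_mult.
  assert (K1 := Cmod_ge_0 (f w - f z)). assert (K2 := Cmod_ge_0 (g w - g z)).
  assert (E1 : e <= 1) by apply Rmin_l.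
  assert (E2 : e * (2 + Cmod (f z) + Cmod (g z)) <= eps).
  { apply Rle_trans with (eps / (2 + Cmod (f z) + Cmod (g z)) * (2 + Cmod (f z) + Cmod (g z))).
    - apply Rmult_le_compat_r; [lra|apply Rmin_r].
    - right. field. lra. }
  nra.
Qed.

Lemma ccont_minus f g z : ccont f z -> ccont g z -> ccont (fun w => f w - g w)%C z.
Proof.
  intros Hf Hg. unfold Cminus. apply ccont_plus; auto.
  intros eps Heps. destruct (Hg eps Heps) as [d [Hd H]]. exists d; split; auto.
  intros w Hw. replace (- g w - - g z)%C with (- (g w - g z))%C by ring.
  rewrite Cmod_opp. auto.
Qed.

Lemma ccont_inv z : z <> RtoC 0 -> ccont Cinv z.
Proof.
  intros Hz eps Heps. assert (Hz' : 0 < Cmod z) by (apply Cmod_gt_0; auto).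
  exists (Rmin (Cmod z / 2) (eps * Cmod z * Cmod z / 4)). split.
  { apply Rmin_pos; [lra|]. assert (0 < eps * Cmod z * Cmod z) by (repeat apply Rmult_lt_0_compat; auto). lra. }
  intros w Hw.
  assert (Hw1 := Rlt_le_trans _ _ _ Hw (Rmin_l _ _)).
  assert (Hw2 := Rlt_le_trans _ _ _ Hw (Rmin_r _ _)).
  assert (Hwz : Cmod z / 2 < Cmod w).
  { assert (H := Cmod_le_dist z w). rewrite Cmod_minus_sym in Hw1. lra. }
  assert (Hw0 : w <> RtoC 0) by (apply Cmod_gt_0; lra).
  replace (/ w - / z)%C with ((z - w) / (w * z))%C by (field; auto).
  rewrite Cmod_div by (apply Cmult_neq_0; auto).
  rewrite Cmod_mult, Cmod_minus_sym.
  apply Rmult_lt_reg_r with (Cmod w * Cmod z); [apply Rmult_lt_0_compat; lra|].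
  unfold Rdiv. rewrite Rmult_assoc, Rinv_l, Rmult_1_r
    by (apply Rgt_not_eq, Rmult_lt_0_compat; lra).
  eapply Rlt_le_trans; [exact Hw2|].
  apply Rle_trans with (eps * (Cmod z / 2 * Cmod z)).
  - assert (0 < eps * Cmod z * Cmod z) by (repeat apply Rmult_lt_0_compat; auto). lra.
  - apply Rmult_le_compat_l; [lra|]. apply Rmult_le_compat_r; lra.
Qed.

Lemma ccont_div f g z : ccont f z -> ccont g z -> g z <> RtoC 0 ->
  ccont (fun w => f w / g w)%C z.
Proof.
  intros Hf Hg H0. unfold Cdiv. apply ccont_mult; auto.
  apply (ccont_comp Cinv g); auto. apply ccont_inv; auto.
Qed.

Lemma ccont_ext_ball f g z r : 0 < r -> (forall w, Cmod (w - z) < r -> f w = g w) ->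
  ccont f z -> ccont g z.
Proof.
  intros Hr E H eps Heps. destruct (H eps Heps) as [d [Hd H1]].
  exists (Rmin d r). split. { apply Rmin_pos; auto. }
  intros w Hw.
  assert (Hw1 := Rlt_le_trans _ _ _ Hw (Rmin_l _ _)).
  assert (Hw2 := Rlt_le_trans _ _ _ Hw (Rmin_r _ _)).
  rewrite <- !E; auto. rewrite Cmod_minus_diag. auto.
Qed.

Lemma is_derive_eps (f : R -> R) (x l : R) : is_derive f x l <->
  forall eps, 0 < eps -> exists d, 0 < d /\ forall y, Rabs (y - x) < d ->
    Rabs (f y - f x - l * (y - x)) <= eps * Rabs (y - x).
Proof.
  split.
  - intros [_ H] eps Heps.
    destruct (H x (fun P HP => HP) (mkposreal eps Heps)) as [d Hd].
    exists d. split; [apply cond_pos|]. intros y Hy. specialize (Hd y Hy).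
    unfold norm, minus, plus, opp, scal in Hd; simpl in Hd.
    unfold abs, mult in Hd; simpl in Hd.
    replace (f y - f x - l * (y - x)) with (f y + - f x + - ((y + - x) * l)) by ring.
    exact Hd.
  - intro H. split; [apply is_linear_scal_l|].
    intros x' Hx' eps.
    assert (E := @is_filter_lim_locally_unique R_AbsRing R_NormedModule x x' Hx'). subst x'.
    destruct (H eps (cond_pos eps)) as [d [Hd H1]].
    exists (mkposreal d Hd). intros y Hy. specialize (H1 y Hy).
    unfold norm, minus, plus, opp, scal; simpl. unfold abs, mult; simpl.
    replace (f y + - f x + - ((y + - x) * l)) with (f y - f x - l * (y - x)) by ring.
    exact H1.
Qed.

Lemma rder_Re_Im c t v : rder c t v <->
  is_derive (fun s => Re (c s)) t (Re v) /\ is_derive (fun s => Im (c s)) t (Im v).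
Proof.
  split.
  - intro H. split; apply is_derive_eps; intros eps Heps;
      destruct (H eps Heps) as [d [Hd H1]]; exists d; split; auto;
      intros y Hy; eapply Rle_trans; [|apply (H1 y Hy)| |apply (H1 y Hy)].
    + eapply Rle_trans; [|apply re_le_Cmod]. right. f_equal.
      destruct (c y), (c t), v; simpl. ring.
    + eapply Rle_trans; [|apply Im_le_Cmod]. right. f_equal.
      destruct (c y), (c t), v; simpl. ring.
  - intros [H1 H2] eps Heps.
    apply is_derive_eps with (eps := eps / 2) in H1; [|lra].
    apply is_derive_eps with (eps := eps / 2) in H2; [|lra].
    destruct H1 as [d1 [Hd1 H1]]. destruct H2 as [d2 [Hd2 H2]].
    exists (Rmin d1 d2). split; [apply Rmin_pos; auto|].
    intros s Hs.
    specialize (H1 s (Rlt_le_trans _ _ _ Hs (Rmin_l _ _))).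
    specialize (H2 s (Rlt_le_trans _ _ _ Hs (Rmin_r _ _))).
    eapply Rle_trans; [apply Cmod_Re_Im_le|].
    replace (Re (c s - c t - v * RtoC (s - t))%C) with (Re (c s) - Re (c t) - Re v * (s - t))
      by (destruct (c s), (c t), v; simpl; ring).
    replace (Im (c s - c t - v * RtoC (s - t))%C) with (Im (c s) - Im (c t) - Im v * (s - t))
      by (destruct (c s), (c t), v; simpl; ring).
    lra.
Qed.

Lemma is_derive_continuity_pt (f : R -> R) x l : is_derive f x l -> continuity_pt f x.
Proof.
  intro H. apply derivable_continuous_pt. exists l. apply is_derive_Reals. exact H.
Qed.

(** The mean value theorem with equality fails for complex values, so it is applied to the real
    inner product of [c t] with the fixed vector [c 1 - c 0]; Cauchy-Schwarz then bounds the
    derivative. *)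
Lemma MVT_curve (c v : R -> C) (M : R) :
  (forall t, 0 <= t <= 1 -> rder c t (v t)) ->
  (forall t, 0 <= t <= 1 -> Cmod (v t) <= M) -> Cmod (c 1 - c 0) <= M.
Proof.
  intros Hd HM.
  set (a := Re (c 1 - c 0)%C). set (b := Im (c 1 - c 0)%C).
  assert (Hm : Cmod (c 1 - c 0) * Cmod (c 1 - c 0) = a * a + b * b).
  { assert (H := Cmod2_alt (c 1 - c 0)). fold a b in H. simpl in H. lra. }
  destruct (MVT_gen (fun t => a * Re (c t) + b * Im (c t)) 0 1
    (fun t => a * Re (v t) + b * Im (v t))) as [t [Ht E]].
  - intros t Ht. rewrite Rmin_left, Rmax_right in Ht by lra.
    destruct (proj1 (rder_Re_Im _ _ _) (Hd t ltac:(lra))) as [H1 H2].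
    apply (is_derive_plus (fun t => a * Re (c t)) (fun t => b * Im (c t)) t
      (a * Re (v t)) (b * Im (v t)));
      [apply (is_derive_scal (fun t => Re (c t)))|apply (is_derive_scal (fun t => Im (c t)))]; auto.
  - intros t Ht. rewrite Rmin_left, Rmax_right in Ht by lra.
    destruct (proj1 (rder_Re_Im _ _ _) (Hd t Ht)) as [H1 H2].
    apply is_derive_continuity_pt with (a * Re (v t) + b * Im (v t)).
    apply (is_derive_plus (fun t => a * Re (c t)) (fun t => b * Im (c t)) t
      (a * Re (v t)) (b * Im (v t)));
      [apply (is_derive_scal (fun t => Re (c t)))|apply (is_derive_scal (fun t => Im (c t)))]; auto.
  - rewrite Rmin_left, Rmax_right in Ht by lra.
    assert (Ea : a = Re (c 1) - Re (c 0)) by (unfold a; destruct (c 1), (c 0); reflexivity).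
    assert (Eb : b = Im (c 1) - Im (c 0)) by (unfold b; destruct (c 1), (c 0); reflexivity).
    assert (E' : a * a + b * b = a * Re (v t) + b * Im (v t)).
    { rewrite Ea, Eb in *. lra. }
    assert (CS : a * Re (v t) + b * Im (v t) <= Cmod (c 1 - c 0) * Cmod (v t)).
    { rewrite <- (Cmod_conj (c 1 - c 0)), <- Cmod_mult.
      eapply Rle_trans; [|apply re_le_Cmod]. eapply Rle_trans; [|apply Rle_abs].
      right. unfold a, b. destruct (c 1), (c 0), (v t); simpl. ring. }
    specialize (HM t Ht).
    assert (H0 := Cmod_ge_0 (c 1 - c 0)). assert (H1 := Cmod_ge_0 (v t)).
    destruct (Rle_lt_or_eq_dec _ _ H0) as [Hp|Hp]; [|lra].
    apply Rmult_le_reg_l with (Cmod (c 1 - c 0)); auto.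
    nra.
Qed.

Lemma rder_segment (a b : C) t : rder (fun s => a + RtoC s * (b - a))%C t (b - a)%C.
Proof.
  intros eps Heps. exists 1. split; [lra|]. intros s _.
  replace (a + RtoC s * (b - a) - (a + RtoC t * (b - a)) - (b - a) * RtoC (s - t))%C
    with (RtoC 0) by (rewrite RtoC_minus; ring).
  rewrite Cmod_0. assert (H := Rabs_pos (s - t)). nra.
Qed.

Lemma segment_ball (y a b : C) r t : Cmod (a - y) < r -> Cmod (b - y) < r -> 0 <= t <= 1 ->
  Cmod (a + RtoC t * (b - a) - y) < r.
Proof.
  intros Ha Hb Ht.
  replace (a + RtoC t * (b - a) - y)%C
    with (RtoC (1 - t) * (a - y) + RtoC t * (b - y))%C by (rewrite RtoC_minus; ring).
  eapply Rle_lt_trans; [apply Cmod_triangle|].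
  rewrite !Cmod_mult, !Cmod_R, !Rabs_pos_eq by lra.
  assert (H1 := Cmod_ge_0 (a - y)). assert (H2 := Cmod_ge_0 (b - y)).
  destruct (Rle_lt_or_eq_dec _ _ (proj1 Ht)); nra.
Qed.

Lemma MVT_segment (g g' : C -> C) (M : R) (a b : C) :
  (forall t, 0 <= t <= 1 -> cder g (a + RtoC t * (b - a))%C (g' (a + RtoC t * (b - a))%C) /\
    Cmod (g' (a + RtoC t * (b - a))%C) <= M) ->
  Cmod (g b - g a) <= M * Cmod (b - a).
Proof.
  intro Hg.
  assert (H := MVT_curve (fun t => g (a + RtoC t * (b - a))%C)
    (fun t => g' (a + RtoC t * (b - a)) * (b - a))%C (M * Cmod (b - a))).
  simpl in H.
  replace (a + RtoC 1 * (b - a))%C with b in H by ring.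
  replace (a + RtoC 0 * (b - a))%C with a in H by ring.
  apply H.
  - intros t Ht. apply (rder_comp g (fun s => a + RtoC s * (b - a))%C).
    + apply Hg; auto.
    + apply rder_segment.
  - intros t Ht. rewrite Cmod_mult. apply Rmult_le_compat_r; [apply Cmod_ge_0|].
    apply Hg; auto.
Qed.

Lemma MVT_ball (g g' : C -> C) (z : C) (r M : R) :
  (forall w, Cmod (w - z) < r -> cder g w (g' w)) ->
  (forall w, Cmod (w - z) < r -> Cmod (g' w) <= M) ->
  forall a b, Cmod (a - z) < r -> Cmod (b - z) < r ->
    Cmod (g b - g a) <= M * Cmod (b - a).
Proof.
  intros Hg HM a b Ha Hb. apply MVT_segment with (g' := g').
  intros t Ht. split; [apply Hg|apply HM]; apply segment_ball; auto.
Qed.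

Lemma is_derive_weighted_square (p q : R -> R) (k t p' q' : R) :
  is_derive p t p' -> is_derive q t q' ->
  is_derive (fun s => (p s * p s + q s * q s) * exp (- k * s)) t
    ((2 * (p t * p' + q t * q') - k * (p t * p t + q t * q t)) * exp (- k * t)).
Proof.
  intros Hp Hq. auto_derive.
  - repeat split; eexists; eauto.
  - replace (Derive (fun s => p s) t) with p' by (symmetry; apply is_derive_unique; auto).
    replace (Derive (fun s => q s) t) with q' by (symmetry; apply is_derive_unique; auto).
    ring.
Qed.

(** Along the segment, |h|^2 exp(-2BDt) with D = |b - a| has nonpositive derivative. The square
    keeps the function differentiable at zeros of [h]. *)
Lemma gronwall_segment (h h' : C -> C) (B : R) (a b : C) : 0 <= B ->
  (forall t, 0 <= t <= 1 -> cder h (a + RtoC t * (b - a))%C (h' (a + RtoC t * (b - a))%C) /\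
    Cmod (h' (a + RtoC t * (b - a))%C) <= B * Cmod (h (a + RtoC t * (b - a))%C)) ->
  Cmod (h b) <= exp (B * Cmod (b - a)) * Cmod (h a).
Proof.
  intros HB H.
  set (D := Cmod (b - a)). assert (HD : 0 <= D) by apply Cmod_ge_0.
  set (c := fun t : R => h (a + RtoC t * (b - a))%C).
  set (v := fun t : R => (h' (a + RtoC t * (b - a)) * (b - a))%C).
  assert (Hc : forall t, 0 <= t <= 1 -> rder c t (v t)).
  { intros t Ht. apply (rder_comp h (fun s => a + RtoC s * (b - a))%C).
    - apply H; auto.
    - apply rder_segment. }
  set (psi := fun t => (Re (c t) * Re (c t) + Im (c t) * Im (c t)) * exp (- (2 * B * D) * t)).
  set (dpsi := fun t => (2 * (Re (c t) * Re (v t) + Im (c t) * Im (v t))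
     - 2 * B * D * (Re (c t) * Re (c t) + Im (c t) * Im (c t))) * exp (- (2 * B * D) * t)).
  assert (Hpsi : forall t, 0 <= t <= 1 -> is_derive psi t (dpsi t)).
  { intros t Ht. destruct (proj1 (rder_Re_Im _ _ _) (Hc t Ht)) as [H1 H2].
    exact (is_derive_weighted_square _ _ _ _ _ _ H1 H2). }
  destruct (MVT_gen psi 0 1 dpsi) as [t [Ht E]].
  - intros t Ht. rewrite Rmin_left, Rmax_right in Ht by lra. apply Hpsi; lra.
  - intros t Ht. rewrite Rmin_left, Rmax_right in Ht by lra.
    apply is_derive_continuity_pt with (dpsi t). auto.
  - rewrite Rmin_left, Rmax_right in Ht by lra.
    assert (Hm : forall t, Cmod (c t) * Cmod (c t) = Re (c t) * Re (c t) + Im (c t) * Im (c t)).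
    { intro s. assert (K := Cmod2_alt (c s)). simpl in K. lra. }
    assert (CS : Re (c t) * Re (v t) + Im (c t) * Im (v t) <= Cmod (c t) * Cmod (v t)).
    { rewrite <- (Cmod_conj (c t)), <- Cmod_mult.
      eapply Rle_trans; [|apply re_le_Cmod]. eapply Rle_trans; [|apply Rle_abs].
      right. destruct (c t), (v t); simpl. ring. }
    assert (Hv : Cmod (v t) <= B * D * Cmod (c t)).
    { unfold v. rewrite Cmod_mult. fold D. destruct (H t Ht) as [_ H1].
      unfold c. assert (K := Cmod_ge_0 (h (a + RtoC t * (b - a))%C)). nra. }
    assert (Hle : psi 1 <= psi 0).
    { assert (dpsi t <= 0); [|lra].
      unfold dpsi. rewrite <- Hm.
      assert (K := exp_pos (- (2 * B * D) * t)).
      assert (K' := Cmod_ge_0 (c t)).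
      assert (Cmod (c t) * Cmod (v t) <= Cmod (c t) * (B * D * Cmod (c t)))
        by (apply Rmult_le_compat_l; auto).
      nra. }
    unfold psi in Hle. rewrite <- !Hm in Hle.
    rewrite Rmult_0_r, exp_0, Rmult_1_r, Rmult_1_r in Hle.
    unfold c in Hle.
    replace (a + RtoC 1 * (b - a))%C with b in Hle by ring.
    replace (a + RtoC 0 * (b - a))%C with a in Hle by ring.
    apply Rsqr_incr_0_var; [|apply Rmult_le_pos; [left; apply exp_pos|apply Cmod_ge_0]].
    unfold Rsqr.
    replace (exp (B * D) * Cmod (h a) * (exp (B * D) * Cmod (h a)))
      with (exp (2 * B * D) * (Cmod (h a) * Cmod (h a)))
      by (replace (2 * B * D) with (B * D + B * D) by ring; rewrite exp_plus; ring).
    apply Rmult_le_reg_r with (exp (- (2 * B * D))); [apply exp_pos|].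
    eapply Rle_trans; [exact Hle|].
    rewrite exp_Ropp. right. field. apply Rgt_not_eq, exp_pos.
Qed.

Lemma gronwall_ball (h h' : C -> C) (B : R) (y : C) (r : R) : 0 <= B ->
  (forall w, Cmod (w - y) < r -> cder h w (h' w)) ->
  (forall w, Cmod (w - y) < r -> Cmod (h' w) <= B * Cmod (h w)) ->
  forall a b, Cmod (a - y) < r -> Cmod (b - y) < r ->
  Cmod (h b) <= exp (B * Cmod (b - a)) * Cmod (h a).
Proof.
  intros HB H1 H2 a b Ha Hb. apply gronwall_segment with (h' := h'); auto.
  intros t Ht. split; [apply H1|apply H2]; apply segment_ball; auto.
Qed.

(** Completeness of C with an explicit rate; it serves the doubling argument, the Newton iteration
    and the diagonal subsequence. *)
Lemma geometric_limit (u : nat -> C) (c : R) :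
  (forall k, Cmod (u (S k) - u k) <= c * (1/2)^k) ->
  exists l, forall k, Cmod (l - u k) <= 2 * c * (1/2)^k.
Proof.
  intro H.
  assert (Hc : 0 <= c).
  { assert (K := H 0%nat). simpl in K. assert (K' := Cmod_ge_0 (u 1%nat - u 0%nat)). lra. }
  assert (Hp : forall k, 0 < (1/2)^k) by (intro k; apply pow_lt; lra).
  assert (Hdist : forall k n, Cmod (u (k + n)%nat - u k) <= 2 * c * (1/2)^k - 2 * c * (1/2)^(k+n)).
  { intros k n. induction n as [|n IH].
    - rewrite Nat.add_0_r, Cmod_minus_diag. lra.
    - rewrite Nat.add_succ_r.
      eapply Rle_trans; [apply (Cmod_dist_triangle _ (u (k + n)%nat))|].
      specialize (H (k + n)%nat). simpl. lra. }
  assert (Hsmall : forall eps : posreal, exists N, forall n, (N <= n)%nat -> 2 * c * (1/2)^n < eps).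
  { intro eps.
    destruct (pow_lt_1_zero (1/2)) with (y := eps / (2 * c + 1)) as [N HN].
    - rewrite Rabs_pos_eq; lra.
    - apply Rdiv_lt_0_compat; [apply cond_pos|lra].
    - exists N. intros n Hn. specialize (HN n Hn).
      rewrite Rabs_pos_eq in HN by (left; apply Hp).
      apply Rle_lt_trans with ((2 * c + 1) * (1/2)^n).
      + specialize (Hp n). nra.
      + apply Rmult_lt_reg_r with (/ (2 * c + 1)); [apply Rinv_0_lt_compat; lra|].
        replace ((2 * c + 1) * (1 / 2) ^ n * / (2 * c + 1)) with ((1/2)^n) by (field; lra).
        exact HN. }
  (* [p] stands for [Re] and [Im], so that real completeness is used once for both coordinates. *)
  assert (Hcau : forall (p : C -> R), (forall a b, Rabs (p a - p b) <= Cmod (a - b)) ->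
    ex_lim_seq_cauchy (fun k => p (u k))).
  { intros p Hpp eps. destruct (Hsmall eps) as [N HN]. exists N.
    assert (W : forall n m, (N <= n)%nat -> (n <= m)%nat -> Rabs (p (u n) - p (u m)) < eps).
    { intros n m Hn Hm. eapply Rle_lt_trans; [apply Hpp|].
      rewrite Cmod_minus_sym. replace m with (n + (m - n))%nat by lia.
      eapply Rle_lt_trans; [apply Hdist|]. specialize (HN n Hn).
      specialize (Hp (n + (m - n))%nat).
      assert (0 <= 2 * c * (1 / 2) ^ (n + (m - n))) by nra. lra. }
    intros n m Hn Hm. destruct (Nat.le_ge_cases n m); auto.
    rewrite Rabs_minus_sym. auto. }
  assert (HR := Hcau Re). assert (HI := Hcau Im).
  destruct (proj2 (ex_lim_seq_cauchy_corr _) (HR ltac:(intros a b; replace (Re a - Re b) with (Re (a - b)%C) by (destruct a, b; reflexivity); apply re_le_Cmod))) as [x Hx].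
  destruct (proj2 (ex_lim_seq_cauchy_corr _) (HI ltac:(intros a b; replace (Im a - Im b) with (Im (a - b)%C) by (destruct a, b; reflexivity); apply Im_le_Cmod))) as [y Hy].
  exists (x, y). intro k. apply le_epsilon. intros eps Heps.
  apply is_lim_seq_spec in Hx. apply is_lim_seq_spec in Hy.
  assert (He2 : 0 < eps / 2) by lra.
  destruct (Hx (mkposreal _ He2)) as [N1 HN1]. destruct (Hy (mkposreal _ He2)) as [N2 HN2].
  set (n := (N1 + N2)%nat).
  specialize (HN1 (k + n)%nat ltac:(unfold n; lia)).
  specialize (HN2 (k + n)%nat ltac:(unfold n; lia)). simpl in HN1, HN2.
  eapply Rle_trans; [apply (Cmod_dist_triangle _ (u (k + n)%nat))|].
  assert (K1 : Cmod ((x, y) - u (k + n)%nat) <= eps).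
  { rewrite Cmod_minus_sym. eapply Rle_trans; [apply Cmod_Re_Im_le|].
    destruct (u (k + n)%nat) as [p q]; simpl in *. unfold Rminus in *. lra. }
  assert (K2 := Hdist k n). specialize (Hp (k + n)%nat).
  assert (0 <= 2 * c * (1 / 2) ^ (k + n)) by nra. lra.
Qed.

(** * Cauchy's estimate *)

Definition cis (t : R) : C := (cos t, sin t).

Lemma Cmod_cis t : Cmod (cis t) = 1.
Proof.
  unfold Cmod, cis. simpl fst; simpl snd.
  rewrite <- sqrt_1. f_equal. assert (H := sin2_cos2 t). unfold Rsqr in H. simpl. lra.
Qed.

Lemma rder_cis t : rder cis t (Ci * cis t)%C.
Proof.
  apply rder_Re_Im. unfold cis; simpl. split; auto_derive; auto; ring.
Qed.

Lemma cis_lipschitz s t : Cmod (cis s - cis t) <= Rabs (s - t).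
Proof.
  assert (H := MVT_curve (fun x => cis (t + x * (s - t)))
    (fun x => (Ci * cis (t + x * (s - t))) * RtoC (s - t))%C (Rabs (s - t))).
  simpl in H. rewrite Rmult_1_l, Rmult_0_l, Rplus_0_r in H.
  replace (t + (s - t)) with s in H by ring. apply H.
  - intros x _. apply rder_Re_Im. unfold cis; simpl. split; auto_derive; auto; ring.
  - intros x _. rewrite !Cmod_mult, Cmod_cis, Cmod_Ci, Cmod_R. lra.
Qed.

Lemma cis_conj_mult t : (Cconj (cis t) * cis t = 1)%C.
Proof.
  unfold cis, Cconj, Cmult; simpl. assert (H := sin2_cos2 t). unfold Rsqr in H.
  apply injective_projections; simpl; lra.
Qed.

Section Circle.
Variables (G G' : C -> C) (R0 : R).
Hypothesis HG : hol G G' (RtoC 0) R0.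

(** The factor exp(-it) singles out the first Taylor coefficient: the mean of [F r] over a full turn
    is r Re G'(0). [dF] is the derivative of [F] in the radius. *)
Let F (r t : R) : R := Re (Cconj (cis t) * G (RtoC r * cis t))%C.
Let dF (r t : R) : R := Re (G' (RtoC r * cis t)%C).

Lemma circle_ball r t : Rabs r < R0 -> Cmod (RtoC r * cis t - RtoC 0) < R0.
Proof.
  intro H. replace (RtoC r * cis t - RtoC 0)%C with (RtoC r * cis t)%C by ring.
  rewrite Cmod_mult, Cmod_cis, Cmod_R. lra.
Qed.

Lemma circle_derive_radius r t : Rabs r < R0 -> is_derive (fun s => F s t) r (dF r t).
Proof.
  intro Hr. destruct (HG _ (circle_ball r t Hr)) as [Hd _].
  assert (H : rder (fun s => Cconj (cis t) * G (RtoC s * cis t))%C r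
    ((Cconj (cis t) * G' (RtoC r * cis t)) * cis t)%C).
  { apply (rder_comp (fun w => Cconj (cis t) * G w)%C (fun s => RtoC s * cis t)%C).
    - apply cder_scal. exact Hd.
    - intros eps Heps. exists 1. split; [lra|]. intros s _.
      replace (RtoC s * cis t - RtoC r * cis t - cis t * RtoC (s - r))%C with (RtoC 0)
        by (rewrite RtoC_minus; ring).
      rewrite Cmod_0. assert (K := Rabs_pos (s - r)). nra. }
  apply rder_Re_Im in H. destruct H as [H _].
  replace (Cconj (cis t) * G' (RtoC r * cis t) * cis t)%C with (G' (RtoC r * cis t)%C) in H.
  - exact H.
  - replace (Cconj (cis t) * G' (RtoC r * cis t) * cis t)%C
      with (Cconj (cis t) * cis t * G' (RtoC r * cis t))%C by ring.
    rewrite cis_conj_mult. ring.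
Qed.

(** The identity behind both parts is d/dt [exp(-it) G(r exp(it))] = i (r G'(r exp(it)) - exp(-it)
    G(r exp(it))). The real part yields continuity of [F] in the angle, the imaginary part the
    integration by parts. *)
Lemma circle_derive_angle r t : Rabs r < R0 ->
  is_derive (fun s => F r s) t
    (Re (Cconj (cis t) * (G' (RtoC r * cis t) * (RtoC r * (Ci * cis t)) - Ci * G (RtoC r * cis t)))%C) /\
  is_derive (fun s => Im (Cconj (cis s) * G (RtoC r * cis s))%C) t (r * dF r t - F r t).
Proof.
  intro Hr. destruct (HG _ (circle_ball r t Hr)) as [Hd _].
  assert (H : rder (fun s => G (RtoC r * cis s))%C t
    (G' (RtoC r * cis t) * (RtoC r * (Ci * cis t)))%C).
  { apply (rder_comp G (fun s => RtoC r * cis s)%C); auto.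
    apply (rder_comp (fun w => RtoC r * w)%C cis); [|apply rder_cis].
    assert (E := cder_scal (RtoC r) _ _ _ (cder_id (cis t))).
    rewrite Cmult_1_r in E. exact E. }
  assert (K := cis_conj_mult t).
  apply rder_Re_Im in H. destruct H as [H1 H2].
  set (a := fun s => Re (G (RtoC r * cis s)%C)) in *.
  set (b := fun s => Im (G (RtoC r * cis s)%C)) in *.
  assert (Ea : forall s, G (RtoC r * cis s)%C = (a s, b s)).
  { intro s. unfold a, b. destruct (G _); reflexivity. }
  assert (Da : Derive (fun s => a s) t = Re (G' (RtoC r * cis t) * (RtoC r * (Ci * cis t)))%C)
    by (apply is_derive_unique; auto).
  assert (Db : Derive (fun s => b s) t = Im (G' (RtoC r * cis t) * (RtoC r * (Ci * cis t)))%C)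
    by (apply is_derive_unique; auto).
  split.
  - apply is_derive_ext with (fun s => cos s * a s + sin s * b s).
    { intro s. unfold F. rewrite Ea. simpl. ring. }
    auto_derive.
    + repeat split; eexists; eauto.
    + rewrite Da, Db, Ea. unfold cis; simpl. ring.
  - apply is_derive_ext with (fun s => cos s * b s - sin s * a s).
    { intro s. rewrite Ea. simpl. ring. }
    auto_derive.
    + repeat split; eexists; eauto.
    + rewrite Da, Db. unfold dF, F. rewrite Ea.
      assert (S := sin2_cos2 t). unfold Rsqr in S.
      set (g := G' (RtoC r * cis t)%C). destruct g as [p q]. unfold cis; simpl.
      assert (S' : cos t * cos t = 1 - sin t * sin t) by lra.
      ring_simplify.
      replace (cos t ^ 2) with (1 - sin t ^ 2) by (simpl; lra). ring.
Qed.

Lemma circle_derivative_continuous r t : Rabs r < R0 ->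
  forall eps, 0 < eps -> exists d, 0 < d /\ forall r' t', Rabs (r' - r) < d -> Rabs (t' - t) < d ->
    Rabs (dF r' t' - dF r t) < eps.
Proof.
  intros Hr eps Heps. destruct (HG _ (circle_ball r t Hr)) as [_ Hc].
  destruct (Hc eps Heps) as [d [Hd H]].
  assert (Hr0 := Rabs_pos r).
  exists (d / (2 + Rabs r)). split. { apply Rdiv_lt_0_compat; lra. }
  intros r' t' Hr' Ht'. unfold dF.
  replace (Re (G' (RtoC r' * cis t')%C) - Re (G' (RtoC r * cis t)%C))
    with (Re (G' (RtoC r' * cis t') - G' (RtoC r * cis t))%C)
    by (destruct (G' (RtoC r' * cis t')%C), (G' (RtoC r * cis t)%C); reflexivity).
  eapply Rle_lt_trans; [apply re_le_Cmod|]. apply H.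
  replace (RtoC r' * cis t' - RtoC r * cis t)%C
    with (RtoC (r' - r) * cis t' + RtoC r * (cis t' - cis t))%C
    by (rewrite RtoC_minus; ring).
  eapply Rle_lt_trans; [apply Cmod_triangle|].
  rewrite !Cmod_mult, !Cmod_R, Cmod_cis.
  assert (L := cis_lipschitz t' t).
  assert (E : d / (2 + Rabs r) * (2 + Rabs r) = d) by (field; lra).
  assert (0 < d / (2 + Rabs r)) by (apply Rdiv_lt_0_compat; lra).
  assert (Rabs r * Cmod (cis t' - cis t) <= Rabs r * (d / (2 + Rabs r)))
    by (apply Rmult_le_compat_l; lra).
  nra.
Qed.

Let P (r : R) : R := RInt (fun t => F r t) 0 (2 * PI).
Let Q (r : R) : R := RInt (fun t => dF r t) 0 (2 * PI).

Lemma F_continuous r t : Rabs r < R0 -> continuous (fun s => F r s) t.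
Proof.
  intro Hr. destruct (circle_derive_angle r t Hr) as [H _].
  apply continuity_pt_filterlim. eapply is_derive_continuity_pt; eauto.
Qed.

Lemma dF_continuous r t : Rabs r < R0 -> continuous (fun s => dF r s) t.
Proof.
  intro Hr. apply continuity_pt_filterlim. intros eps Heps.
  destruct (circle_derivative_continuous r t Hr eps Heps) as [d [Hd H]].
  exists d. split; auto. intros s [_ Hs]. apply H; auto.
  rewrite Rminus_diag, Rabs_R0. auto.
Qed.

Lemma F_integrable r : Rabs r < R0 -> ex_RInt (fun t => F r t) 0 (2 * PI).
Proof.
  intro Hr. apply (ex_RInt_continuous (V := R_CompleteNormedModule)).
  intros t _. apply F_continuous; auto.
Qed.

Lemma dF_integrable r : Rabs r < R0 -> ex_RInt (fun t => dF r t) 0 (2 * PI).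
Proof.
  intro Hr. apply (ex_RInt_continuous (V := R_CompleteNormedModule)).
  intros t _. apply dF_continuous; auto.
Qed.

(* Integration by parts over the closed circle. *)
Lemma circle_by_parts r : Rabs r < R0 -> P r = r * Q r.
Proof.
  intro Hr.
  set (p := fun s => Im (Cconj (cis s) * G (RtoC r * cis s))%C).
  assert (E : p (2 * PI) = p 0).
  { unfold p, cis. rewrite cos_2PI, sin_2PI, cos_0, sin_0. reflexivity. }
  assert (HI : is_RInt (fun t => r * dF r t - F r t) 0 (2 * PI) (minus (p (2 * PI)) (p 0))).
  { apply (is_RInt_derive (V := R_CompleteNormedModule)).
    - intros t _. exact (proj2 (circle_derive_angle r t Hr)).
    - intros t _. apply (continuous_minus (fun t => r * dF r t) (fun t => F r t)).
      + apply (continuous_scal_r r (fun t => dF r t)), dF_continuous; auto.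
      + apply F_continuous; auto. }
  replace (minus (p (2 * PI)) (p 0)) with 0 in HI
    by (rewrite E; unfold minus, plus, opp; simpl; ring).
  assert (HU := is_RInt_unique (V := R_CompleteNormedModule) _ _ _ _ HI).
  assert (E2 : RInt (fun t => r * dF r t - F r t) 0 (2 * PI) = r * Q r - P r).
  { apply (is_RInt_unique (V := R_CompleteNormedModule)).
    apply (is_RInt_minus (fun t => r * dF r t) (fun t => F r t)).
    - apply (is_RInt_scal (fun t => dF r t)). apply (RInt_correct (V := R_CompleteNormedModule)), dF_integrable; auto.
    - apply (RInt_correct (V := R_CompleteNormedModule)), F_integrable; auto. }
  rewrite E2 in HU. lra.
Qed.

Lemma circle_integral_derive r : Rabs r < R0 -> is_derive P r (Q r).
Proof.
  intro Hr.
  assert (Hloc : forall s, Rabs (s - r) < R0 - Rabs r -> Rabs s < R0).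
  { intros s Hs. replace s with (r + (s - r)) by ring.
    eapply Rle_lt_trans; [apply Rabs_triang|]. lra. }
  assert (Hpos : 0 < R0 - Rabs r) by lra.
  replace (Q r) with (RInt (fun t => Derive (fun u => F u t) r) 0 (2 * PI)).
  - apply is_derive_RInt_param.
    + exists (mkposreal _ Hpos). intros s Hs t _. exists (dF s t).
      apply circle_derive_radius, Hloc, Hs.
    + intros t _ eps.
      destruct (circle_derivative_continuous r t Hr eps (cond_pos eps)) as [d [Hd H]].
      assert (Hm : 0 < Rmin d (R0 - Rabs r)) by (apply Rmin_pos; auto).
      exists (mkposreal _ Hm). simpl. intros u v Hu Hv.
      assert (Hu1 := Rlt_le_trans _ _ _ Hu (Rmin_l _ _)).
      assert (Hu2 := Rlt_le_trans _ _ _ Hu (Rmin_r _ _)).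
      assert (Hv1 := Rlt_le_trans _ _ _ Hv (Rmin_l _ _)).
      change (Rabs (Derive (fun s => F s v) u - Derive (fun s => F s t) r) < eps).
      replace (Derive (fun s => F s v) u) with (dF u v)
        by (symmetry; apply is_derive_unique, circle_derive_radius; auto).
      replace (Derive (fun s => F s t) r) with (dF r t)
        by (symmetry; apply is_derive_unique, circle_derive_radius; auto).
      auto.
    + exists (mkposreal _ Hpos). intros s Hs. apply F_integrable, Hloc, Hs.
  - apply RInt_ext. intros t _. apply is_derive_unique, circle_derive_radius; auto.
Qed.

(** Since P' = Q and P = rQ, the quotient P/r has zero derivative for positive radius. So P is
    linear there, and its slope is the derivative Q(0) at the centre, where [dF] is constant in the
    angle. *)
Lemma circle_integral r : 0 < r < R0 -> P r = r * (2 * PI * Re (G' (RtoC 0))).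
Proof.
  intros Hr.
  assert (Hab : forall s, 0 <= s <= r -> Rabs s < R0) by (intros s Hs; rewrite Rabs_pos_eq; lra).
  assert (H0 : P 0 = 0) by (rewrite circle_by_parts; [ring|apply Hab; lra]).
  assert (HQ : Q 0 = 2 * PI * Re (G' (RtoC 0))).
  { unfold Q, dF. rewrite (RInt_ext _ (fun _ => Re (G' (RtoC 0)))).
    - rewrite RInt_const. unfold scal; simpl. unfold mult; simpl. ring.
    - intros t _. replace (RtoC 0 * cis t)%C with (RtoC 0) by ring. reflexivity. }
  assert (Hlin : forall s, 0 < s < r -> P s = s * (P r / r)).
  { intros s Hs.
    destruct (MVT_gen (fun u => P u / u) s r (fun _ => 0)) as [u [_ E]].
    - intros u Hu. rewrite Rmin_left, Rmax_right in Hu by lra.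
      assert (D := circle_integral_derive u (Hab u ltac:(lra))).
      assert (B := circle_by_parts u (Hab u ltac:(lra))).
      auto_derive.
      + split; [eexists; eauto|]. split; auto. lra.
      + replace (Derive (fun x => P x) u) with (Q u)
          by (symmetry; apply is_derive_unique; auto).
        rewrite B. field. lra.
    - intros u Hu. rewrite Rmin_left, Rmax_right in Hu by lra.
      assert (D := circle_integral_derive u (Hab u ltac:(lra))).
      apply continuity_pt_div; [eapply is_derive_continuity_pt; eauto|apply continuity_pt_id|unfold id; lra].
    - rewrite Rmult_0_l in E. replace (P r / r) with (P s / s) by lra. field. lra. }
  assert (E : P r / r = Q 0).
  { apply cond_eq. intros eps Heps.
    destruct (proj1 (is_derive_eps P 0 (Q 0)) (circle_integral_derive 0 (Hab 0 ltac:(lra))) (eps / 2))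
      as [d [Hd H]]; [lra|].
    set (s := Rmin (d / 2) (r / 2)).
    assert (Hs0 : 0 < s) by (apply Rmin_pos; lra).
    assert (Hs1 : s <= d / 2) by apply Rmin_l.
    assert (Hs2 : s <= r / 2) by apply Rmin_r.
    specialize (H s). rewrite H0, !Rminus_0_r, (Rabs_pos_eq s) in H by lra.
    specialize (H ltac:(lra)). rewrite Hlin in H by lra.
    replace (s * (P r / r) - Q 0 * s) with (s * (P r / r - Q 0)) in H by ring.
    rewrite Rabs_mult, (Rabs_pos_eq s) in H by lra. nra. }
  rewrite HQ in E. rewrite <- E. field. lra.
Qed.

Lemma circle_estimate r M : 0 < r < R0 ->
  (forall w, Cmod w = r -> Cmod (G w) <= M) -> r * Re (G' (RtoC 0)) <= M.
Proof.
  intros Hr HM.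
  assert (E := circle_integral r Hr).
  assert (A : Rabs (P r) <= (2 * PI - 0) * M).
  { assert (Hpi := PI_RGT_0). apply abs_RInt_le_const; [lra| |].
    - apply F_integrable. rewrite Rabs_pos_eq; lra.
    - intros t _. unfold F. eapply Rle_trans; [apply re_le_Cmod|].
      rewrite Cmod_mult, Cmod_conj, Cmod_cis, Rmult_1_l. apply HM.
      rewrite Cmod_mult, Cmod_cis, Cmod_R, Rabs_pos_eq; lra. }
  assert (Hpi := PI_RGT_0). assert (L := Rle_abs (P r)).
  apply Rmult_le_reg_l with (2 * PI); lra.
Qed.

End Circle.

Lemma hol_scal c g g' z r : hol g g' z r -> hol (fun w => c * g w)%C (fun w => c * g' w)%C z r.
Proof.
  intros H w Hw. destruct (H w Hw). split; [apply cder_scal; auto|].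
  apply ccont_mult; auto. apply ccont_const.
Qed.

(** [circle_estimate] sees only a real part; multiplying [G] by the conjugate of G'(0) makes the
    derivative at 0 equal to the real number |G'(0)|^2. *)
Lemma cauchy_estimate G G' R0 r M : hol G G' (RtoC 0) R0 -> 0 < r < R0 ->
  (forall w, Cmod w = r -> Cmod (G w) <= M) -> r * Cmod (G' (RtoC 0)) <= M.
Proof.
  intros HG Hr HM.
  set (a := G' (RtoC 0)).
  assert (H := circle_estimate _ _ _ (hol_scal (Cconj a) _ _ _ _ HG) r (Cmod a * M) Hr).
  assert (Ha := Cmod_ge_0 a).
  destruct (Rle_lt_or_eq_dec _ _ Ha) as [Hp|Hp].
  - apply Rmult_le_reg_l with (Cmod a); auto.
    eapply Rle_trans; [|apply H].
    + right. fold a. assert (K := Cmod2_alt a). destruct a as [x y]; simpl in *.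
      rewrite Rmult_1_r in K. rewrite <- Rmult_assoc, (Rmult_comm _ r), Rmult_assoc, K. ring.
    + intros w Hw. rewrite Cmod_mult, Cmod_conj. apply Rmult_le_compat_l; auto.
  - rewrite <- Hp, Rmult_0_r.
    eapply Rle_trans; [apply Cmod_ge_0|apply (HM (RtoC r))]. rewrite Cmod_R, Rabs_pos_eq; lra.
Qed.

Lemma hol_translate g g' z r R0 : hol g g' z R0 -> forall a, Cmod (a - z) + r <= R0 ->
  hol (fun w => g (a + w))%C (fun w => g' (a + w))%C (RtoC 0) r.
Proof.
  intros H a Ha w Hw.
  replace (w - RtoC 0)%C with w in Hw by ring.
  assert (Hin : Cmod (a + w - z) < R0).
  { replace (a + w - z)%C with ((a - z) + w)%C by ring.
    eapply Rle_lt_trans; [apply Cmod_triangle|]. lra. }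
  destruct (H _ Hin) as [H1 H2].
  assert (Hd : cder (fun w => a + w)%C w (RtoC 0 + RtoC 1)%C)
    by (apply cder_plus; [apply cder_const|apply cder_id]).
  split.
  - replace (g' (a + w)%C) with (g' (a + w) * (RtoC 0 + RtoC 1))%C by ring.
    apply (cder_comp g (fun w => a + w)%C); auto.
  - apply (ccont_comp g' (fun w => a + w)%C); auto. eapply cder_ccont; eauto.
Qed.

Lemma hol_minus f f' g g' z r : hol f f' z r -> hol g g' z r ->
  hol (fun w => f w - g w)%C (fun w => f' w - g' w)%C z r.
Proof.
  intros Hf Hg w Hw. destruct (Hf w Hw), (Hg w Hw).
  split; [apply cder_minus|apply ccont_minus]; auto.
Qed.

(* Cauchy's estimate for [L (a + w) - L (b + w)]: no bound on a second derivative is needed. *)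
Lemma lipschitz_derivative L L' z e M : 0 < e -> hol L L' z e ->
  (forall w, Cmod (w - z) < e -> Cmod (L' w) <= M) ->
  forall a b, Cmod (a - z) < e / 4 -> Cmod (b - z) < e / 4 ->
  Cmod (L' a - L' b) <= 2 * M / e * Cmod (a - b).
Proof.
  intros He HL HM a b Ha Hb.
  assert (H1 := hol_translate _ _ _ (3 * e / 4) _ HL a ltac:(lra)).
  assert (H2 := hol_translate _ _ _ (3 * e / 4) _ HL b ltac:(lra)).
  (* The circle of radius e/2 around [a] or [b] stays in the disc of radius e, where the mean value
     inequality bounds the difference by M |a - b|. *)
  assert (H := cauchy_estimate _ _ _ (e / 2) (M * Cmod (a - b)) (hol_minus _ _ _ _ _ _ H1 H2) ltac:(lra)).
  cbv beta in H. replace (a + RtoC 0)%C with a in H by ring.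
  replace (b + RtoC 0)%C with b in H by ring.
  apply Rmult_le_reg_l with (e / 2); [lra|].
  replace (e / 2 * (2 * M / e * Cmod (a - b))) with (M * Cmod (a - b)) by (field; lra).
  apply H. intros w Hw.
  assert (Hin : forall c, Cmod (c - z) < e / 4 -> Cmod (c + w - z) < e).
  { intros c Hc. replace (c + w - z)%C with ((c - z) + w)%C by ring.
    eapply Rle_lt_trans; [apply Cmod_triangle|]. lra. }
  replace (a - b)%C with (a + w - (b + w))%C by ring.
  apply (MVT_ball L L' z e M); auto. intros v Hv. apply HL; auto.
Qed.

(** * Exponential and logarithms *)

Lemma Cexp_plus a b : Cexp (a + b) = (Cexp a * Cexp b)%C.
Proof.
  destruct a as [x y], b as [u v]. unfold Cexp; simpl.
  rewrite exp_plus, cos_plus, sin_plus. unfold Cmult; simpl. f_equal; ring.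
Qed.

Lemma Cexp_0 : Cexp (RtoC 0) = RtoC 1.
Proof. unfold Cexp; simpl. rewrite exp_0, cos_0, sin_0. unfold RtoC. f_equal; ring. Qed.

Lemma Cmod_Cexp z : Cmod (Cexp z) = exp (Re z).
Proof.
  replace (Cexp z) with (RtoC (exp (Re z)) * cis (Im z))%C
    by (unfold Cexp, cis, RtoC, Cmult; simpl; f_equal; ring).
  rewrite Cmod_mult, Cmod_cis, Cmod_R, Rabs_pos_eq; [ring|left; apply exp_pos].
Qed.

Lemma Cexp_neq_0 z : Cexp z <> RtoC 0.
Proof. apply Cmod_gt_0. rewrite Cmod_Cexp. apply exp_pos. Qed.

Lemma Cexp_minus a b : Cexp (a - b) = (Cexp a / Cexp b)%C.
Proof.
  assert (H := Cexp_neq_0 b).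
  replace (Cexp a) with (Cexp (a - b) * Cexp b)%C by (rewrite <- Cexp_plus; f_equal; ring).
  field. auto.
Qed.

Lemma Cexp_eq_1 z : Cexp z = RtoC 1 -> exists k : Z, z = (0, 2 * PI * IZR k).
Proof.
  intro H.
  assert (Hm : exp (Re z) = 1) by (rewrite <- Cmod_Cexp, H, Cmod_1; reflexivity).
  assert (Hre : Re z = 0) by (apply exp_inv; rewrite exp_0; auto).
  unfold Cexp in H. rewrite Hre, exp_0, !Rmult_1_l in H.
  assert (Hc : cos (Im z) = 1) by (apply (f_equal fst) in H; exact H).
  assert (Hs : sin (Im z / 2) = 0).
  { replace (Im z) with (2 * (Im z / 2)) in Hc by field.
    rewrite cos_2a_sin in Hc. nra. }
  destruct (sin_eq_0_0 _ Hs) as [k Hk]. exists k.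
  destruct z as [x y]; simpl in *. f_equal; [auto|].
  replace y with (2 * (y / 2)) by field. rewrite Hk. ring.
Qed.

Lemma Cexp_2PI : Cexp (0, 2 * PI) = RtoC 1.
Proof. unfold Cexp; simpl. rewrite exp_0, cos_2PI, sin_2PI. unfold RtoC. f_equal; ring. Qed.

Lemma rder_Cexp_line u t : rder (fun s => Cexp (RtoC s * u)) t (u * Cexp (RtoC t * u))%C.
Proof.
  apply rder_Re_Im. destruct u as [x y]. unfold Cexp; simpl.
  split; auto_derive; auto; unfold Rminus; ring.
Qed.

Lemma exp_line_le u t : 0 <= t <= 1 -> exp (Re (RtoC t * u)%C) <= exp (Cmod u).
Proof.
  intro Ht. assert (H : Re (RtoC t * u)%C <= Cmod u).
  { eapply Rle_trans; [apply Rle_abs|]. eapply Rle_trans; [apply re_le_Cmod|].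
    rewrite Cmod_mult, Cmod_R, Rabs_pos_eq by lra. assert (K := Cmod_ge_0 u). nra. }
  destruct H as [H|H]; [left; apply exp_increasing; auto|rewrite H; lra].
Qed.

Lemma Cexp_minus_1 u : Cmod (Cexp u - 1) <= Cmod u * exp (Cmod u).
Proof.
  assert (H := MVT_curve (fun t => Cexp (RtoC t * u)) (fun t => u * Cexp (RtoC t * u))%C
    (Cmod u * exp (Cmod u))). simpl in H.
  rewrite Cmult_1_l, Cmult_0_l, Cexp_0 in H. apply H.
  - intros t _. apply rder_Cexp_line.
  - intros t Ht. rewrite Cmod_mult, Cmod_Cexp.
    apply Rmult_le_compat_l; [apply Cmod_ge_0|apply exp_line_le; auto].
Qed.

Lemma Cexp_minus_linear u : Cmod (Cexp u - 1 - u) <= Cmod u * Cmod u * exp (Cmod u).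
Proof.
  assert (H := MVT_curve (fun t => Cexp (RtoC t * u) - RtoC t * u)%C
    (fun t => u * (Cexp (RtoC t * u) - 1))%C
    (Cmod u * Cmod u * exp (Cmod u))). simpl in H.
  rewrite Cmult_1_l, Cmult_0_l, Cexp_0 in H.
  replace (Cexp u - 1 - u)%C with (Cexp u - u - (RtoC 1 - RtoC 0))%C by ring.
  apply H.
  - intros t _. apply rder_Re_Im.
    destruct (proj1 (rder_Re_Im _ _ _) (rder_Cexp_line u t)) as [H1 H2].
    destruct u as [x y]. unfold Cexp; simpl.
    split; auto_derive; auto; unfold Rminus; ring.
  - intros t Ht. rewrite Cmod_mult, Rmult_assoc.
    apply Rmult_le_compat_l; [apply Cmod_ge_0|].
    eapply Rle_trans; [apply Cexp_minus_1|].
    assert (K := Cmod_ge_0 u).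
    assert (E : Cmod (RtoC t * u) <= Cmod u)
      by (rewrite Cmod_mult, Cmod_R, Rabs_pos_eq by lra; nra).
    apply Rmult_le_compat; auto; [apply Cmod_ge_0|left; apply exp_pos|].
    destruct E as [E|E]; [left; apply exp_increasing; auto|rewrite E; lra].
Qed.

Lemma cder_Cexp z : cder Cexp z (Cexp z).
Proof.
  intros eps Heps. assert (Hz : 0 < Cmod (Cexp z)) by (rewrite Cmod_Cexp; apply exp_pos).
  exists (Rmin 1 (eps / (3 * Cmod (Cexp z)))). split.
  { apply Rmin_pos; [lra|]. apply Rdiv_lt_0_compat; lra. }
  intros w Hw.
  assert (Hw1 := Rlt_le_trans _ _ _ Hw (Rmin_l _ _)).
  assert (Hw2 := Rlt_le_trans _ _ _ Hw (Rmin_r _ _)).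
  set (u := (w - z)%C) in *.
  replace (Cexp w - Cexp z - Cexp z * u)%C with (Cexp z * (Cexp u - 1 - u))%C.
  2:{ replace w with (z + u)%C by (unfold u; ring). rewrite Cexp_plus. ring. }
  rewrite Cmod_mult.
  assert (E := Cexp_minus_linear u). assert (K := Cmod_ge_0 u).
  assert (E3 : exp (Cmod u) <= 3).
  { eapply Rle_trans; [|apply exp_le_3]. left. apply exp_increasing. auto. }
  assert (E4 : Cmod (Cexp u - 1 - u) <= 3 * Cmod u * Cmod u).
  { eapply Rle_trans; [exact E|]. nra. }
  apply Rle_trans with (Cmod (Cexp z) * (3 * Cmod u * Cmod u)).
  { apply Rmult_le_compat_l; lra. }
  assert (3 * Cmod (Cexp z) * Cmod u <= eps).
  { apply Rle_trans with (3 * Cmod (Cexp z) * (eps / (3 * Cmod (Cexp z)))).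
    - apply Rmult_le_compat_l; lra.
    - right. field. lra. }
  nra.
Qed.

Lemma ccont_real_comp (g : R -> R) (phi : C -> R) z : continuity_pt g (phi z) ->
  ccont (fun w => RtoC (phi w)) z -> ccont (fun w => RtoC (g (phi w))) z.
Proof.
  intros Hg Hp eps Heps. destruct (Hg eps Heps) as [d [Hd H]].
  destruct (Hp d Hd) as [e [He H']]. exists e. split; auto. intros w Hw.
  specialize (H' w Hw). rewrite <- RtoC_minus, Cmod_R in *.
  destruct (Req_dec (phi w) (phi z)) as [E|E].
  - rewrite E, Rminus_diag, Rabs_R0. auto.
  - apply H. repeat split; auto.
Qed.

(** The principal logarithm on the right half-plane, to which every use is confined. *)
Definition Clog (w : C) : C := (ln (Cmod w), atan (Im w / Re w)).

Lemma Cexp_Clog w : 0 < Re w -> Cexp (Clog w) = w.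
Proof.
  intro H. destruct w as [a b]; simpl in *.
  assert (Hm : 0 < Cmod (a, b)).
  { eapply Rlt_le_trans; [|apply re_le_Cmod]. simpl. rewrite Rabs_pos_eq; lra. }
  unfold Cexp, Clog; simpl. rewrite exp_ln by auto.
  assert (S : sqrt (1 + (b / a)²) = Cmod (a, b) / a).
  { replace (1 + (b / a)²) with ((Cmod (a, b) / a)²).
    - apply sqrt_Rsqr. apply Rlt_le, Rdiv_lt_0_compat; auto.
    - assert (K := Cmod2_alt (a, b)). simpl in K. rewrite !Rmult_1_r in K.
      unfold Rsqr. apply Rmult_eq_reg_r with (a * a); [|nra].
      field_simplify; try lra. }
  rewrite cos_atan, sin_atan, S. f_equal; field; lra.
Qed.

Lemma ccont_Clog w : 0 < Re w -> ccont Clog w.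
Proof.
  intro H.
  assert (Hm : 0 < Cmod w).
  { eapply Rlt_le_trans; [|apply re_le_Cmod]. rewrite Rabs_pos_eq; lra. }
  assert (C1 : ccont (fun w => RtoC (ln (Cmod w))) w).
  { apply (ccont_real_comp ln Cmod).
    - apply derivable_continuous_pt. exists (/ Cmod w). apply derivable_pt_lim_ln; auto.
    - intros eps Heps. exists eps. split; auto. intros v Hv.
      rewrite <- RtoC_minus, Cmod_R.
      assert (K1 := Cmod_le_dist v w). assert (K2 := Cmod_le_dist w v).
      rewrite (Cmod_minus_sym w v) in K2. apply Rabs_def1; lra. }
  assert (Creal : ccont (fun v => RtoC (Re v)) w).
  { intros eps Heps. exists eps. split; auto. intros v Hv.
    eapply Rle_lt_trans; [|exact Hv]. rewrite <- RtoC_minus, Cmod_R.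
    eapply Rle_trans; [|apply re_le_Cmod]. right. destruct v, w; reflexivity. }
  assert (Cimag : ccont (fun v => RtoC (Im v)) w).
  { intros eps Heps. exists eps. split; auto. intros v Hv.
    eapply Rle_lt_trans; [|exact Hv]. rewrite <- RtoC_minus, Cmod_R.
    eapply Rle_trans; [|apply Im_le_Cmod]. right. destruct v, w; reflexivity. }
  assert (C2 : ccont (fun w => RtoC (atan (Im w / Re w))) w).
  { apply (ccont_real_comp atan (fun w => Im w / Re w)).
    - apply derivable_continuous_pt. eexists. apply derivable_pt_lim_atan.
    - apply (ccont_ext_ball (fun v => RtoC (Im v) / RtoC (Re v))%C _ w (Re w)); auto.
      + intros v Hv. rewrite <- RtoC_div; auto.
        assert (Re (w - v)%C < Re w).
        { eapply Rle_lt_trans; [apply Rle_abs|]. eapply Rle_lt_trans; [apply re_le_Cmod|].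
          rewrite Cmod_minus_sym. auto. }
        destruct v, w; simpl in *. lra.
      + apply ccont_div; auto. intro E. apply RtoC_inj in E. lra. }
  apply (ccont_ext_ball (fun v => RtoC (ln (Cmod v)) + Ci * RtoC (atan (Im v / Re v)))%C _ w 1); [lra| |].
  - intros v _. unfold Clog, RtoC, Ci, Cmult, Cplus; simpl. f_equal; ring.
  - apply ccont_plus; auto. apply ccont_mult; auto. apply ccont_const.
Qed.

(** With u = L w - L z one has h w = h z exp u. Continuity of [L] makes u small, and then exp u - 1
    is u up to a small relative error. *)
Lemma cder_log (L h : C -> C) z r l : 0 < r ->
  (forall w, Cmod (w - z) < r -> Cexp (L w) = h w) ->
  ccont L z -> cder h z l -> cder L z (l / h z)%C.
Proof.
  intros Hr HL Hc Hh eps Heps.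
  assert (Hz0 : Cexp (L z) = h z) by (apply HL; rewrite Cmod_minus_diag; auto).
  assert (Hnz : h z <> RtoC 0) by (rewrite <- Hz0; apply Cexp_neq_0).
  assert (Hz : 0 < Cmod (h z)) by (apply Cmod_gt_0; auto).
  assert (Hl := Cmod_ge_0 l).
  set (m := Cmod (h z)) in *.
  set (e1 := Rmin 1 (m * eps / 2)).
  assert (He1 : 0 < e1) by (apply Rmin_pos; nra).
  set (e2 := Rmin (1/2) (eps * m / (4 * (Cmod l + 1)))).
  assert (He2 : 0 < e2).
  { apply Rmin_pos; [lra|]. apply Rdiv_lt_0_compat; nra. }
  destruct (Hh e1 He1) as [d1 [Hd1 H1]].
  destruct (cder_Cexp (RtoC 0) e2 He2) as [eta [Heta He]].
  destruct (Hc eta Heta) as [d2 [Hd2 H2]].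
  exists (Rmin r (Rmin d1 d2)). split; [repeat apply Rmin_pos; auto|].
  intros w Hw.
  assert (Hw0 := Rlt_le_trans _ _ _ Hw (Rmin_l _ _)).
  assert (Hw' := Rlt_le_trans _ _ _ Hw (Rmin_r _ _)).
  assert (Hw1 := Rlt_le_trans _ _ _ Hw' (Rmin_l _ _)).
  assert (Hw2 := Rlt_le_trans _ _ _ Hw' (Rmin_r _ _)).
  specialize (H1 w Hw1). specialize (H2 w Hw2).
  set (u := (L w - L z)%C) in *.
  specialize (He u). rewrite Cexp_0 in He.
  replace (u - RtoC 0)%C with u in He by ring. specialize (He H2).
  rewrite Cmult_1_l in He.
  assert (Ehw : h w = (h z * Cexp u)%C).
  { rewrite <- HL by auto. rewrite <- Hz0, <- Cexp_plus. f_equal. unfold u. ring. }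
  assert (Hu := Cmod_ge_0 u). assert (Hx := Cmod_ge_0 (w - z)).
  assert (A1 : m * Cmod u <= Cmod (h w - h z) + m * (e2 * Cmod u)).
  { unfold m. rewrite <- Cmod_mult.
    replace (h z * u)%C with ((h w - h z) - h z * (Cexp u - RtoC 1 - u))%C by (rewrite Ehw; ring).
    eapply Rle_trans; [apply Cmod_minus_le|]. rewrite Cmod_mult.
    apply Rplus_le_compat_l, Rmult_le_compat_l; auto. apply Cmod_ge_0. }
  assert (A2 : Cmod (h w - h z) <= (Cmod l + 1) * Cmod (w - z)).
  { replace (h w - h z)%C with ((h w - h z - l * (w - z)) + l * (w - z))%C by ring.
    eapply Rle_trans; [apply Cmod_triangle|]. rewrite Cmod_mult.
    assert (e1 <= 1) by apply Rmin_l. nra. }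
  (* A first crude bound on u, linear in |w - z|: as e2 <= 1/2, half of m |u| is absorbed on the
     left. It then makes the error e2 |u| small compared with |w - z|. *)
  assert (A3 : m * Cmod u <= 2 * (Cmod l + 1) * Cmod (w - z)).
  { assert (e2 <= 1/2) by apply Rmin_l.
    assert (m * (e2 * Cmod u) <= m * (1/2 * Cmod u)).
    { apply Rmult_le_compat_l; [lra|]. apply Rmult_le_compat_r; auto. }
    lra. }
  apply Rmult_le_reg_l with m; auto.
  unfold m at 1. rewrite <- Cmod_mult.
  replace (h z * (u - l / h z * (w - z)))%C
    with ((h w - h z - l * (w - z)) - h z * (Cexp u - RtoC 1 - u))%C
    by (rewrite Ehw; field; auto).
  eapply Rle_trans; [apply Cmod_minus_le|]. rewrite Cmod_mult. fold m.
  assert (B1 : m * Cmod (Cexp u - RtoC 1 - u) <= m * eps / 2 * Cmod (w - z)).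
  { apply Rle_trans with (m * (e2 * Cmod u)); [apply Rmult_le_compat_l; lra|].
    replace (m * (e2 * Cmod u)) with (e2 * (m * Cmod u)) by ring.
    apply Rle_trans with (eps * m / (4 * (Cmod l + 1)) * (2 * (Cmod l + 1) * Cmod (w - z))).
    - apply Rmult_le_compat; try lra; [|apply Rmin_r]. apply Rmult_le_pos; lra.
    - right. field. lra. }
  assert (e1 * Cmod (w - z) <= m * eps / 2 * Cmod (w - z))
    by (apply Rmult_le_compat_r; auto; apply Rmin_r).
  lra.
Qed.

(** No path integral is taken: the segment from y to w is cut into N pieces so short that
    consecutive values of [h] have ratio in the right half-plane, and the principal logarithms of
    the ratios are added. The bound [B] on the logarithmic derivative lets one N work for all w. *)
Lemma log_exists (h h' : C -> C) (y : C) (r B : R) : 0 < r -> 0 <= B ->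
  hol h h' y r ->
  (forall w, Cmod (w - y) < r -> h w <> RtoC 0) ->
  (forall w, Cmod (w - y) < r -> Cmod (h' w) <= B * Cmod (h w)) ->
  exists L, L y = RtoC 0 /\
    (forall w, Cmod (w - y) < r -> Cexp (L w) = h w / h y)%C /\
    hol L (fun w => h' w / h w)%C y r.
Proof.
  intros Hr HB Hh Hnz Hbd.
  assert (Hy : Cmod (y - y) < r) by (rewrite Cmod_minus_diag; auto).
  assert (Hcont : forall w, Cmod (w - y) < r -> ccont h w)
    by (intros w Hw; eapply cder_ccont; apply Hh; auto).
  (* This gives B r / N <= 1/4; by Gronwall |h| grows on one piece by at most exp(1/4) <= 3, so each
     ratio lies within 3/4 of 1. *)
  destruct (nfloor_ex (4 * (B * r))) as [N0 [_ HN0]]; [nra|].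
  set (N := S N0).
  assert (HN : 4 * (B * r) < INR N) by (unfold N; rewrite S_INR; auto).
  assert (HNpos : 0 < INR N) by (unfold N; rewrite S_INR; assert (K := pos_INR N0); lra).
  set (p := fun (k : nat) (w : C) => (y + RtoC (INR k / INR N) * (w - y))%C).
  assert (Hp : forall k w, (k <= N)%nat -> Cmod (w - y) < r -> Cmod (p k w - y) < r).
  { intros k w Hk Hw. unfold p. apply segment_ball; auto.
    apply le_INR in Hk. assert (K := pos_INR k). split.
    - apply Rmult_le_pos; auto. left. apply Rinv_0_lt_compat; auto.
    - apply Rmult_le_reg_r with (INR N); auto. unfold Rdiv. rewrite Rmult_assoc, Rinv_l; lra. }
  assert (Hpc : forall k w, ccont (p k) w).
  { intros k w. unfold p. apply ccont_plus; [apply ccont_const|].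
    apply ccont_mult; [apply ccont_const|]. apply ccont_minus; [apply ccont_id|apply ccont_const]. }
  (* Only continuity is carried through the induction; differentiability of the final sum comes from
     [cder_log]. *)
  assert (Hcl : forall k, (k <= N)%nat -> exists L,
    (forall w, Cmod (w - y) < r -> Cexp (L w) = h (p k w) / h y)%C /\
    forall w, Cmod (w - y) < r -> ccont L w).
  { induction k as [|k IH]; intro Hk.
    - exists (fun _ => RtoC 0). split; [|intros; apply ccont_const].
      intros w Hw. rewrite Cexp_0.
      replace (p 0%nat w) with y by (unfold p; simpl; unfold Rdiv; rewrite Rmult_0_l; ring).
      field. apply Hnz; auto.
    - destruct IH as [L [HL HLc]]; [lia|].
      set (q := fun w => (h (p (S k) w) / h (p k w))%C).
      assert (Hq : forall w, Cmod (w - y) < r -> 0 < Re (q w)).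
      { intros w Hw.
        assert (P0 := Hp k w ltac:(lia) Hw). assert (P1 := Hp (S k) w ltac:(lia) Hw).
        assert (Hd : Cmod (p (S k) w - p k w) <= r / INR N).
        { replace (p (S k) w - p k w)%C with (RtoC (/ INR N) * (w - y))%C.
          - rewrite Cmod_mult, Cmod_R, Rabs_pos_eq by (left; apply Rinv_0_lt_compat; auto).
            unfold Rdiv. rewrite Rmult_comm. apply Rmult_le_compat_r; [|lra].
            left. apply Rinv_0_lt_compat; auto.
          - unfold p. rewrite S_INR.
            replace ((INR k + 1) / INR N) with (INR k / INR N + / INR N) by (field; lra).
            rewrite RtoC_plus. ring. }
        assert (HBN : B * (r / INR N) <= 1 / 4).
        { apply Rmult_le_reg_r with (INR N); auto.
          replace (B * (r / INR N) * INR N) with (B * r) by (field; lra). lra. }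
        assert (Hn0 := Hnz _ P0).
        assert (Hm0 : 0 < Cmod (h (p k w))) by (apply Cmod_gt_0; auto).
        assert (He : exp (1/4) <= 3).
        { eapply Rle_trans; [|apply exp_le_3]. left. apply exp_increasing. lra. }
        assert (Hb : Cmod (h (p (S k) w) - h (p k w)) <= 3 * B * Cmod (h (p k w)) * Cmod (p (S k) w - p k w)).
        { apply MVT_segment with (g' := h'). intros t Ht.
          assert (Hin := segment_ball y _ _ r t P0 P1 Ht).
          split; [apply Hh; auto|]. eapply Rle_trans; [apply Hbd; auto|].
          replace (3 * B * Cmod (h (p k w))) with (B * (3 * Cmod (h (p k w)))) by ring.
          apply Rmult_le_compat_l; auto.
          eapply Rle_trans.
          - apply (gronwall_ball h h' B y r HB (fun v Hv => proj1 (Hh v Hv)) Hbd _ _ P0 Hin).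
          - apply Rmult_le_compat_r; [lra|]. eapply Rle_trans; [|exact He].
            assert (E : B * Cmod (p k w + RtoC t * (p (S k) w - p k w) - p k w) <= 1/4).
            { replace (p k w + RtoC t * (p (S k) w - p k w) - p k w)%C
                with (RtoC t * (p (S k) w - p k w))%C by ring.
              rewrite Cmod_mult, Cmod_R, Rabs_pos_eq by lra.
              eapply Rle_trans; [|exact HBN]. apply Rmult_le_compat_l; auto.
              assert (K := Cmod_ge_0 (p (S k) w - p k w)). nra. }
            destruct E as [E|E]; [left; apply exp_increasing; auto|rewrite E; lra]. }
        assert (Hq1 : Cmod (q w - RtoC 1) <= 3 / 4).
        { replace (q w - RtoC 1)%C with ((h (p (S k) w) - h (p k w)) / h (p k w))%C
            by (unfold q; field; auto).
          rewrite Cmod_div by auto. apply Rmult_le_reg_r with (Cmod (h (p k w))); auto.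
          unfold Rdiv at 1. rewrite Rmult_assoc, Rinv_l by lra. rewrite Rmult_1_r.
          eapply Rle_trans; [exact Hb|].
          replace (3 * B * Cmod (h (p k w)) * Cmod (p (S k) w - p k w))
            with (3 * (B * Cmod (p (S k) w - p k w)) * Cmod (h (p k w))) by ring.
          apply Rmult_le_compat_r; [lra|].
          assert (B * Cmod (p (S k) w - p k w) <= B * (r / INR N)) by (apply Rmult_le_compat_l; auto).
          lra. }
        assert (K := re_le_Cmod (q w - RtoC 1)).
        assert (Rabs (Re (q w - RtoC 1)%C) <= 3/4) by lra.
        apply Rabs_le_between in H. destruct (q w) as [a b]; simpl in *. lra. }
      assert (Hqc : forall w, Cmod (w - y) < r -> ccont q w).
      { intros w Hw. unfold q. apply ccont_div.
        - apply (ccont_comp h (p (S k))); auto.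
        - apply (ccont_comp h (p k)); auto. apply Hcont, Hp; auto; lia.
        - apply Hnz, Hp; auto; lia. }
      exists (fun w => L w + Clog (q w))%C. split.
      + intros w Hw. rewrite Cexp_plus, HL, Cexp_Clog by auto. unfold q.
        field. split; [apply Hnz; auto|apply Hnz, Hp; auto; lia].
      + intros w Hw. apply ccont_plus; auto.
        apply (ccont_comp Clog q); auto. apply ccont_Clog; auto. }
  destruct (Hcl N (le_n _)) as [L [HL HLc]].
  assert (HpN : forall w, p N w = w).
  { intro w. unfold p. replace (INR N / INR N) with 1 by (field; lra). ring. }
  assert (HLy : Cexp (L y) = RtoC 1).
  { rewrite HL, HpN by auto. field. apply Hnz; auto. }
  exists (fun w => L w - L y)%C.
  assert (HE : forall w, Cmod (w - y) < r -> Cexp (L w - L y) = (h w / h y)%C).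
  { intros w Hw. rewrite Cexp_minus, HLy, HL, HpN by auto. field. apply Hnz; auto. }
  split; [ring|]. split; auto.
  intros w Hw. assert (Hc : ccont (fun w => L w - L y)%C w)
    by (apply ccont_minus; auto; apply ccont_const).
  destruct (Hh w Hw) as [D1 D2].
  split; [|apply ccont_div; auto].
  assert (Hny := Hnz y Hy). assert (Hnw := Hnz w Hw).
  replace (h' w / h w)%C with ((/ h y * h' w) / (/ h y * h w))%C by (field; auto).
  apply (cder_log _ (fun v => / h y * h v)%C w (r - Cmod (w - y))); auto; [lra| |].
  - intros v Hv. rewrite HE.
    + unfold Cdiv. ring.
    + eapply Rle_lt_trans; [apply (Cmod_dist_triangle v w y)|]. lra.
  - apply cder_scal; auto.
Qed.

(** * A weak Koebe theorem *)

(* Hofer's doubling argument: otherwise doubling steps accumulate at a point where [phi] blows up. *)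
Lemma doubling_point (phi : C -> R) (z : C) (d : R) : 0 < d -> 0 < phi z ->
  (forall w, Cmod (w - z) < d -> ccont (fun v => RtoC (phi v)) w) ->
  exists z1 e, 0 < e /\ (forall w, Cmod (w - z1) < e -> Cmod (w - z) < d) /\
    phi z * d / 4 <= phi z1 * e /\
    forall w, Cmod (w - z1) < e -> phi w <= 2 * phi z1.
Proof.
  intros Hd Hz Hc. apply NNPP. intro Hno.
  (* The radii halve while [phi] at least doubles, so phi(u k) e(k) never falls below phi(z) d / 4.
     The steps add up to at most d/2, so all discs stay inside the original one. *)
  set (e := fun k : nat => d / 4 * (1 / 2) ^ k).
  assert (He : forall k, 0 < e k) by (intro k; apply Rmult_lt_0_compat; [lra|apply pow_lt; lra]).
  (* A point near [v] where [phi] more than doubles; it exists at every [u k], because otherwise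
     [u k] and [e k] would witness the lemma. *)
  set (next := fun (k : nat) (v : C) => epsilon (inhabits v)
    (fun w => Cmod (w - v) < e k /\ 2 * phi v < phi w)).
  set (u := fix u (k : nat) : C := match k with O => z | S k => next k (u k) end).
  assert (Hinv : forall k, Cmod (u k - z) <= d / 2 - 2 * e k /\ phi z * 2 ^ k <= phi (u k) /\
    Cmod (u (S k) - u k) <= e k /\ 2 * phi (u k) < phi (u (S k))).
  { assert (Hstep : forall k, Cmod (u k - z) <= d / 2 - 2 * e k -> phi z * 2 ^ k <= phi (u k) ->
      Cmod (u (S k) - u k) < e k /\ 2 * phi (u k) < phi (u (S k))).
    { intros k H1 H2. change (u (S k)) with (next k (u k)). unfold next. apply epsilon_spec.
      apply NNPP. intro Hn. apply Hno. exists (u k), (e k).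
      repeat split; auto.
      - intros w Hw. eapply Rle_lt_trans; [apply (Cmod_dist_triangle w (u k))|].
        specialize (He k). lra.
      - unfold e. replace (phi z * d / 4) with (phi z * 2 ^ k * (d / 4 * (1 / 2) ^ k)).
        + apply Rmult_le_compat_r; auto. left. apply (He k).
        + replace (phi z * 2 ^ k * (d / 4 * (1 / 2) ^ k)) with (phi z * d / 4 * (2 ^ k * (1 / 2) ^ k)) by (unfold Rdiv; ring).
          rewrite <- Rpow_mult_distr. replace (2 * (1 / 2)) with 1 by lra. rewrite pow1. ring.
      - intros w Hw. apply Rnot_lt_le. intro K. apply Hn. exists w. auto. }
    assert (Hind : forall k, Cmod (u k - z) <= d / 2 - 2 * e k /\ phi z * 2 ^ k <= phi (u k)).
    { induction k as [|k [IH1 IH2]].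
      - simpl. rewrite Cmod_minus_diag. unfold e. simpl. lra.
      - destruct (Hstep k IH1 IH2) as [S1 S2]. split.
        + eapply Rle_trans; [apply (Cmod_dist_triangle _ (u k))|].
          assert (E : e (S k) = e k / 2) by (unfold e; simpl; field). rewrite E. lra.
        + simpl pow. lra. }
    intro k. destruct (Hind k) as [H1 H2]. destruct (Hstep k H1 H2). repeat split; auto. lra. }
  destruct (geometric_limit u (d / 4)) as [l Hl].
  { intro k. apply Hinv. }
  assert (Hlz : Cmod (l - z) < d).
  { specialize (Hl 0%nat). simpl in Hl. lra. }
  destruct (Hc l Hlz 1 Rlt_0_1) as [eta [Heta H]].
  destruct (pow_lt_1_zero (1/2)) with (y := eta / d) as [N1 HN1].
  { rewrite Rabs_pos_eq; lra. }
  { apply Rdiv_lt_0_compat; lra. }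
  destruct (Pow_x_infinity 2) with (b := (Rabs (phi l) + 2) / phi z) as [N2 HN2].
  { rewrite Rabs_pos_eq; lra. }
  set (k := (N1 + N2)%nat).
  specialize (HN1 k ltac:(unfold k; lia)). specialize (HN2 k ltac:(unfold k; lia)).
  assert (P2 : 0 < 2 ^ k) by (apply pow_lt; lra).
  assert (P12 : 0 < (1/2) ^ k) by (apply pow_lt; lra).
  rewrite Rabs_pos_eq in HN1, HN2 by lra.
  specialize (Hl k).
  assert (Hk : Cmod (u k - l) < eta).
  { rewrite Cmod_minus_sym. apply Rle_lt_trans with (d * (1/2)^k); [nra|].
    apply Rlt_le_trans with (d * (eta / d)).
    - apply Rmult_lt_compat_l; auto.
    - right. field. lra. }
  specialize (H (u k) Hk). rewrite <- RtoC_minus, Cmod_R in H.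
  destruct (Hinv k) as [_ [Hphi _]].
  assert (Rabs (phi l) + 2 <= phi z * 2 ^ k).
  { apply Rge_le in HN2.
    apply Rle_trans with (phi z * ((Rabs (phi l) + 2) / phi z)).
    - right. field. lra.
    - apply Rmult_le_compat_l; lra. }
  apply Rabs_lt_between in H. assert (K := Rle_abs (phi l)). lra.
Qed.

(** Newton's iteration with the derivative frozen at z is a contraction with factor 1/4. The first
    step has length |tau| / |g' z| <= r/8, so the iterates stay within r/4 of z. *)
Lemma newton_solve (g g' : C -> C) (z tau : C) (r : R) : 0 < r -> g' z <> RtoC 0 ->
  (forall w, Cmod (w - z) < r -> cder g w (g' w)) ->
  (forall w, Cmod (w - z) < r -> Cmod (g' w - g' z) <= Cmod (g' z) / 4) ->
  Cmod tau <= Cmod (g' z) * r / 8 ->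
  exists u, Cmod (u - z) < r /\ g u = (g z + tau)%C.
Proof.
  intros Hr HA Hg Hb Ht.
  set (A := g' z) in *. assert (Hm : 0 < Cmod A) by (apply Cmod_gt_0; auto).
  set (T := fun w => (w - / A * (g w - g z - tau))%C).
  assert (HT : forall a b, Cmod (a - z) < r -> Cmod (b - z) < r ->
    Cmod (T b - T a) <= 1 / 4 * Cmod (b - a)).
  { intros a b Ha Hb'.
    assert (H := MVT_ball (fun w => w - / A * g w)%C (fun w => RtoC 1 - / A * g' w)%C z r (1/4)).
    replace (T b - T a)%C with ((b - / A * g b) - (a - / A * g a))%C by (unfold T; ring).
    apply H; auto.
    - intros w Hw. apply cder_minus; [apply cder_id|apply cder_scal; auto].
    - intros w Hw. replace (RtoC 1 - / A * g' w)%C with (- (g' w - A) / A)%C by (field; auto).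
      rewrite Cmod_div, Cmod_opp by auto.
      apply Rmult_le_reg_r with (Cmod A); auto.
      unfold Rdiv at 1. rewrite Rmult_assoc, Rinv_l by lra. specialize (Hb w Hw). lra. }
  set (u := fix u (k : nat) : C := match k with O => z | S k => T (u k) end).
  assert (Hu : forall k, Cmod (u k - z) <= r / 4 - r / 4 * (1/2)^k /\
    Cmod (u (S k) - u k) <= r / 8 * (1/2)^k).
  { induction k as [|k [IH1 IH2]].
    - simpl. rewrite Cmod_minus_diag. split; [lra|].
      replace (T z - z)%C with (tau / A)%C by (unfold T; field; auto).
      rewrite Cmod_div by auto. apply Rmult_le_reg_r with (Cmod A); auto.
      unfold Rdiv at 1. rewrite Rmult_assoc, Rinv_l by lra. lra.
    - assert (Hp : 0 < (1/2)^k) by (apply pow_lt; lra).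
      assert (Hrp : 0 < r * (1/2)^k) by (apply Rmult_lt_0_compat; auto).
      assert (H1 : Cmod (u (S k) - z) <= r / 4 - r / 4 * (1/2)^(S k)).
      { eapply Rle_trans; [apply (Cmod_dist_triangle _ (u k))|]. simpl pow. lra. }
      split; auto.
      assert (H2 : Cmod (T (u (S k)) - T (u k)) <= 1 / 4 * Cmod (u (S k) - u k)).
      { apply HT; [lra|]. eapply Rle_lt_trans; [exact H1|]. simpl pow. lra. }
      eapply Rle_trans; [exact H2|]. rewrite <- tech_pow_Rmult. lra. }
  destruct (geometric_limit u (r / 8)) as [l Hl]; [apply Hu|].
  assert (Hlz : Cmod (l - z) < r).
  { specialize (Hl 0%nat). simpl in Hl. lra. }
  exists l. split; auto.
  assert (E : T l = l).
  { apply Cmod_minus_eq0. apply Rle_antisym; [|apply Cmod_ge_0].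
    apply le_epsilon. intros eps Heps.
    destruct (pow_lt_1_zero (1/2)) with (y := eps / r) as [N HN].
    { rewrite Rabs_pos_eq; lra. }
    { apply Rdiv_lt_0_compat; lra. }
    specialize (HN N (le_n _)).
    assert (Hp : 0 < (1/2)^N) by (apply pow_lt; lra).
    rewrite Rabs_pos_eq in HN by lra.
    assert (HNe : r * (1/2)^N <= eps).
    { apply Rle_trans with (r * (eps / r)); [apply Rmult_le_compat_l; lra|right; field; lra]. }
    eapply Rle_trans; [apply (Cmod_dist_triangle _ (u (S N)))|].
    assert (H1 : Cmod (T l - T (u N)) <= 1/4 * Cmod (l - u N)).
    { apply HT; auto. destruct (Hu N). nra. }
    assert (H2 := Hl N). assert (H3 := Hl (S N)).
    change (u (S N)) with (T (u N)) in *. rewrite (Cmod_minus_sym _ l).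
    simpl pow in *. lra. }
  unfold T in E.
  replace (g l) with (g z + tau + A * (l - (l - / A * (g l - g z - tau))))%C by (field; auto).
  rewrite E. ring.
Qed.

(* If the logarithmic derivative of [h] is too large, a logarithm of [h]
   is nearly linear on a disc big enough to contain two points with values differing by 2 pi i. *)
Lemma koebe (h h' : C -> C) (z : C) (d : R) : 0 < d -> hol h h' z d ->
  (forall w, Cmod (w - z) < d -> h w <> RtoC 0) ->
  (forall v w, Cmod (v - z) < d -> Cmod (w - z) < d -> h v = h w -> v = w) ->
  Cmod (h' z) * d <= 4096 * Cmod (h z).
Proof.
  intros Hd Hh Hnz Hinj. apply Rnot_lt_le. intro Hbig.
  assert (Hzz : Cmod (z - z) < d) by (rewrite Cmod_minus_diag; auto).
  set (phi := fun w => Cmod (h' w / h w)).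
  assert (Hphi_c : forall w, Cmod (w - z) < d -> ccont (fun v => RtoC (phi v)) w).
  { intros w Hw. destruct (Hh w Hw) as [H1 H2].
    assert (H : ccont (fun v => h' v / h v)%C w)
      by (apply ccont_div; auto; eapply cder_ccont; eauto).
    intros eps Heps. destruct (H eps Heps) as [e [He H']]. exists e. split; auto.
    intros v Hv. specialize (H' v Hv). rewrite <- RtoC_minus, Cmod_R. unfold phi.
    assert (K1 := Cmod_le_dist (h' v / h v) (h' w / h w)).
    assert (K2 := Cmod_le_dist (h' w / h w) (h' v / h v)).
    rewrite Cmod_minus_sym in K2. apply Rabs_def1; lra. }
  assert (Hz0 : 0 < Cmod (h z)) by (apply Cmod_gt_0; auto).
  assert (Hphi : 4096 < phi z * d).
  { unfold phi. rewrite Cmod_div by auto.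
    apply Rmult_lt_reg_r with (Cmod (h z)); auto.
    replace (Cmod (h' z) / Cmod (h z) * d * Cmod (h z)) with (Cmod (h' z) * d) by (field; lra). auto. }
  destruct (doubling_point phi z d Hd) as [z1 [e [He [Hsub [HAe Hdbl]]]]]; auto.
  { apply Rmult_lt_reg_r with d; auto. lra. }
  set (A := phi z1) in *.
  assert (HA : 1024 < A * e) by lra.
  assert (HApos : 0 < A) by (apply Rmult_lt_reg_r with e; auto; lra).
  assert (Hh1 : hol h h' z1 e) by (intros w Hw; apply Hh; auto).
  destruct (log_exists h h' z1 e (2 * A)) as [L [HL0 [HLe HLh]]]; auto; [lra| |].
  { intros w Hw. specialize (Hdbl w Hw). unfold phi in Hdbl.
    assert (Hn := Hnz w (Hsub w Hw)). assert (Hm : 0 < Cmod (h w)) by (apply Cmod_gt_0; auto).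
    rewrite Cmod_div in Hdbl by auto.
    apply Rmult_le_reg_r with (/ Cmod (h w)); [apply Rinv_0_lt_compat; auto|].
    rewrite Rmult_assoc, Rinv_r, Rmult_1_r by lra. exact Hdbl. }
  assert (Hz1 : Cmod (z1 - z1) < e) by (rewrite Cmod_minus_diag; auto).
  assert (Hlip := lipschitz_derivative L _ z1 e (2 * A) He HLh Hdbl).
  (* On radius e/16 the Lipschitz constant 4A/e keeps the derivative within A/4 of its value at
     [z1]. Reaching 2 pi i requires 2 pi <= A e / 128, which follows from A e > 1024 and pi <= 4;
     the doubling step lost a factor 4, whence 4096 = 4 * 128 * 8. *)
  destruct (newton_solve L (fun w => h' w / h w)%C z1 (0, 2 * PI) (e / 16)) as [u [Hu1 Hu2]].
  - lra.
  - apply Cmod_gt_0. exact HApos.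
  - intros w Hw. apply HLh. lra.
  - intros w Hw. eapply Rle_trans; [apply Hlip; [lra|rewrite Cmod_minus_diag; lra]|].
    fold (phi z1). fold A.
    apply Rle_trans with (2 * (2 * A) / e * (e / 16)).
    + apply Rmult_le_compat_l; [|lra]. apply Rlt_le, Rdiv_lt_0_compat; lra.
    + right. field. lra.
  - fold (phi z1). fold A.
    eapply Rle_trans; [apply Cmod_Re_Im_le|]. simpl.
    assert (P := PI_4). assert (P0 := PI_RGT_0). rewrite Rabs_R0, Rabs_pos_eq by lra. lra.
  (* [L] differs by 2 pi i at [u] and [z1], so [h] takes the same value there although the points
     are distinct. *)
  - assert (Hue : Cmod (u - z1) < e) by lra.
    assert (E : h u = h z1).
    { assert (H := HLe u Hue). rewrite Hu2, HL0, Cplus_0_l, Cexp_2PI in H.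
      assert (Hn := Hnz z1 (Hsub _ Hz1)).
      replace (h u) with (h u / h z1 * h z1)%C by (field; auto). rewrite <- H. ring. }
    apply Hinj in E; auto. subst u. rewrite HL0 in Hu2.
    apply (f_equal snd) in Hu2. simpl in Hu2. assert (P0 := PI_RGT_0). lra.
Qed.

(** * Normality of equi-Lipschitz families *)

Definition infinite (P : nat -> Prop) : Prop := forall n, exists m, (n <= m)%nat /\ P m.

Lemma pigeonhole_infinite {A : Type} (Rel : nat -> A -> Prop) (l : list A) :
  forall P : nat -> Prop, infinite P ->
  (forall m, P m -> exists c, In c l /\ Rel m c) ->
  exists c, infinite (fun m => P m /\ Rel m c).
Proof.
  induction l as [|a l IH]; intros P HP H.
  - destruct (HP 0%nat) as [m [_ Hm]]. destruct (H m Hm) as [c [[] _]].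
  - destruct (classic (infinite (fun m => P m /\ Rel m a))) as [Ha|Ha]; [eauto|].
    apply not_all_ex_not in Ha. destruct Ha as [n0 Hn0].
    destruct (IH (fun m => (n0 <= m)%nat /\ P m)) as [c Hc].
    + intro n. destruct (HP (n + n0)%nat) as [m [Hm1 Hm2]]. exists m. repeat split; auto; lia.
    + intros m [Hm1 Hm2]. destruct (H m Hm2) as [c [[Hc|Hc] HR]]; [|eauto].
      subst c. exfalso. apply Hn0. exists m. auto.
    + exists c. intro n. destruct (Hc n) as [m [Hm [[_ H1] H2]]]. eauto.
Qed.

Lemma real_net (M eps : R) : 0 < eps -> exists l : list R,
  forall x, Rabs x <= M -> exists c, In c l /\ Rabs (x - c) <= eps.
Proof.
  intro He. destruct (Rlt_le_dec M 0) as [HM|HM].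
  { exists nil. intros x Hx. assert (K := Rabs_pos x). lra. }
  destruct (nfloor_ex (2 * M / eps)) as [N [HN1 HN2]].
  { apply Rmult_le_pos; [lra|]. left. apply Rinv_0_lt_compat; auto. }
  exists (map (fun k => - M + INR k * eps) (seq 0 (S N))).
  intros x Hx. apply Rabs_le_between in Hx.
  assert (Hq : 0 <= (x + M) / eps).
  { apply Rmult_le_pos; [lra|]. left. apply Rinv_0_lt_compat; auto. }
  destruct (nfloor_ex _ Hq) as [k [Hk1 Hk2]].
  assert (E : (x + M) / eps * eps = x + M) by (field; lra).
  exists (- M + INR k * eps). split.
  - apply in_map_iff. exists k. split; auto. apply in_seq.
    assert (INR k < INR (S N)); [|apply INR_lt in H; lia].
    rewrite S_INR. eapply Rle_lt_trans; [exact Hk1|]. eapply Rle_lt_trans; [|exact HN2].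
    apply Rmult_le_compat_r; [left; apply Rinv_0_lt_compat; auto|lra].
  - apply Rabs_le. nra.
Qed.

Lemma complex_net (M eps : R) : 0 < eps -> exists l : list C,
  forall z, Cmod z <= M -> exists c, In c l /\ Cmod (z - c) <= eps.
Proof.
  intro He. destruct (real_net M (eps / 2)) as [l Hl]; [lra|].
  exists (list_prod l l). intros z Hz.
  destruct (Hl (Re z)) as [a [Ha1 Ha2]]; [eapply Rle_trans; [apply re_le_Cmod|auto]|].
  destruct (Hl (Im z)) as [b [Hb1 Hb2]]; [eapply Rle_trans; [apply Im_le_Cmod|auto]|].
  exists (a, b). split; [apply in_prod; auto|].
  eapply Rle_trans; [apply Cmod_Re_Im_le|]. destruct z as [x y]; simpl in *.
  unfold Rminus in *. lra.
Qed.

(** The net must consist of points of [U], where alone the family is bounded and Lipschitz. Each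
    centre of a finer net is replaced by a nearby point of [U], or dropped if there is none. *)
Lemma net_in_subset (U : C -> Prop) (M eps : R) : 0 < eps -> (forall w, U w -> Cmod w <= M) ->
  exists l : list C, (forall c, In c l -> U c) /\
    forall w, U w -> exists c, In c l /\ Cmod (w - c) <= eps.
Proof.
  intros He HU. destruct (complex_net M (eps / 2)) as [l Hl]; [lra|].
  assert (H : forall l : list C, exists l', (forall c, In c l' -> U c) /\
    forall w, U w -> (exists c, In c l /\ Cmod (w - c) <= eps / 2) ->
      exists c, In c l' /\ Cmod (w - c) <= eps).
  { clear l Hl. induction l as [|a l [l' [H1 H2]]].
    - exists nil. split; [intros c []|]. intros w _ [c [[] _]].
    - destruct (classic (exists v, U v /\ Cmod (v - a) <= eps / 2)) as [[v [Hv1 Hv2]]|Hno].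
      + exists (v :: l'). split.
        * intros c [<-|Hc]; auto.
        * intros w Hw [c [[<-|Hc] Hwc]].
          -- exists v. split; [left; auto|].
             eapply Rle_trans; [apply (Cmod_dist_triangle w a v)|].
             rewrite (Cmod_minus_sym a v). lra.
          -- destruct (H2 w Hw) as [c' [Hc' Hd]]; [eauto|]. exists c'. split; [right; auto|auto].
      + exists l'. split; auto. intros w Hw [c [[<-|Hc] Hwc]]; [|eauto].
        exfalso. apply Hno. eauto. }
  destruct (H l) as [l' [H1 H2]]. exists l'. split; auto.
Qed.

Section ArzelaAscoli.
Variables (g : nat -> C -> C) (U : C -> Prop) (M K M' : R).
Hypothesis HU : forall w, U w -> Cmod w <= M.
Hypothesis HK : forall n a b, U a -> U b -> Cmod (g n a - g n b) <= K * Cmod (a - b).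

Lemma refine_at_points (l : list C) (eps : R) : 0 < eps ->
  forall P : nat -> Prop, infinite P ->
  (forall c, In c l -> forall m, P m -> Cmod (g m c) <= M') ->
  exists Q : nat -> Prop, infinite Q /\ (forall m, Q m -> P m) /\
    forall c, In c l -> forall m n, Q m -> Q n -> Cmod (g m c - g n c) <= eps.
Proof.
  intro He. induction l as [|a l IH]; intros P HP Hb.
  - exists P. repeat split; auto. intros c [].
  - destruct (IH P HP) as [Q [HQ [HQP HQe]]].
    { intros c Hc. apply Hb. right; auto. }
    destruct (complex_net M' (eps / 2)) as [net Hnet]; [lra|].
    destruct (pigeonhole_infinite (fun m c => Cmod (g m a - c) <= eps / 2) net Q HQ) as [c Hc].
    { intros m Hm. apply Hnet. apply Hb; [left; auto|auto]. }
    exists (fun m => Q m /\ Cmod (g m a - c) <= eps / 2). repeat split; auto.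
    + intros m [Hm _]. auto.
    + intros c' [<-|Hc'] m n [Hm1 Hm2] [Hn1 Hn2]; [|auto].
      eapply Rle_trans; [apply (Cmod_dist_triangle _ c)|].
      rewrite (Cmod_minus_sym c). lra.
Qed.

Lemma refine_uniform (eps : R) : 0 < eps ->
  forall P : nat -> Prop, infinite P ->
  (forall m, P m -> forall w, U w -> Cmod (g m w) <= M') ->
  exists Q : nat -> Prop, infinite Q /\ (forall m, Q m -> P m) /\
    forall m n, Q m -> Q n -> forall w, U w -> Cmod (g m w - g n w) <= eps.
Proof.
  intros He P HP Hb.
  assert (HKp : 0 < Rabs K + 1) by (assert (J := Rabs_pos K); lra).
  destruct (net_in_subset U M (eps / 3 / (Rabs K + 1))) as [l [Hl1 Hl2]]; auto.
  { apply Rdiv_lt_0_compat; lra. }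
  destruct (refine_at_points l (eps / 3) ltac:(lra) P HP) as [Q [HQ [HQP HQe]]].
  { intros c Hc m Hm. apply Hb; auto. }
  exists Q. repeat split; auto. intros m n Hm Hn w Hw.
  destruct (Hl2 w Hw) as [c [Hc1 Hc2]].
  assert (Hlip : forall k, Cmod (g k w - g k c) <= eps / 3).
  { intro k. eapply Rle_trans; [apply HK; auto|].
    apply Rle_trans with ((Rabs K + 1) * (eps / 3 / (Rabs K + 1))); [|right; field; lra].
    assert (J := Rle_abs K). assert (J' := Cmod_ge_0 (w - c)).
    apply Rle_trans with ((Rabs K + 1) * Cmod (w - c)).
    - apply Rmult_le_compat_r; lra.
    - apply Rmult_le_compat_l; lra. }
  eapply Rle_trans; [apply (Cmod_dist_triangle _ (g m c))|].
  assert (H1 := Hlip m). assert (H2 := Hlip n). assert (H3 := HQe c Hc1 m n Hm Hn).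
  assert (H4 := Cmod_dist_triangle (g m c) (g n c) (g n w)).
  rewrite (Cmod_minus_sym (g n c)) in H4. lra.
Qed.

(** Nested infinite index sets [Qs k] with geometrically shrinking oscillation, followed by a
    diagonal choice. The limit comes with a rate that is uniform on [U]. *)
Lemma arzela_ascoli (P : nat -> Prop) : infinite P ->
  (forall m, P m -> forall w, U w -> Cmod (g m w) <= M') ->
  exists (phi : nat -> nat) (h : C -> C), strictly_increasing phi /\ (forall k, P (phi k)) /\
    forall w, U w -> forall k, Cmod (h w - g (phi k) w) <= 2 * (1/2)^k.
Proof.
  intros HP Hb.
  set (good := fun (k : nat) (Q Q' : nat -> Prop) => infinite Q' /\ (forall m, Q' m -> Q m) /\
    forall m n, Q' m -> Q' n -> forall w, U w -> Cmod (g m w - g n w) <= (1/2)^k).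
  set (Qs := fix Qs (k : nat) : nat -> Prop := match k with
    | O => P
    | S k => epsilon (inhabits P) (good k (Qs k)) end).
  assert (HQ : forall k, infinite (Qs k) /\ (forall m, Qs k m -> P m) /\ good k (Qs k) (Qs (S k))).
  { assert (Hs : forall k, infinite (Qs k) -> (forall m, Qs k m -> P m) -> good k (Qs k) (Qs (S k))).
    { intros k H1 H2. apply (epsilon_spec (inhabits P) (good k (Qs k))).
      apply refine_uniform; auto. apply pow_lt; lra. }
    assert (Hi : forall k, infinite (Qs k) /\ (forall m, Qs k m -> P m)).
    { induction k as [|k [IH1 IH2]]; [split; auto|].
      destruct (Hs k IH1 IH2) as [H1 [H2 _]]. split; auto. }
    intro k. destruct (Hi k). repeat split; auto; apply Hs; auto. }
  (* The shift by one matters: [phi k] and [phi (S k)] both lie in [Qs (S k)], where any two members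
     differ by at most (1/2)^k. *)
  set (phi := fix phi (k : nat) : nat := match k with
    | O => epsilon (inhabits O) (fun n => Qs 1%nat n)
    | S k => epsilon (inhabits O) (fun n => (S (phi k) <= n)%nat /\ Qs (S (S k)) n) end).
  assert (Hphi : forall k, Qs (S k) (phi k)).
  { intros [|k].
    - apply (epsilon_spec (inhabits O) (fun n => Qs 1%nat n)).
      destruct (HQ 1%nat) as [H _]. destruct (H 0%nat) as [m [_ Hm]]. eauto.
    - apply (epsilon_spec (inhabits O) (fun n => (S (phi k) <= n)%nat /\ Qs (S (S k)) n)).
      apply HQ. }
  assert (Hinc : strictly_increasing phi).
  { intro k. assert (H : (S (phi k) <= phi (S k))%nat); [|lia].
    apply (epsilon_spec (inhabits O) (fun n => (S (phi k) <= n)%nat /\ Qs (S (S k)) n)).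
    apply HQ. }
  exists phi, (fun w => epsilon (inhabits w)
    (fun l => forall k, Cmod (l - g (phi k) w) <= 2 * (1/2)^k)).
  split; [exact Hinc|]. split.
  { intro k. apply (proj1 (proj2 (HQ (S k)))). auto. }
  intros w Hw. apply epsilon_spec.
  destruct (geometric_limit (fun k => g (phi k) w) 1) as [l Hl].
  { intro k. rewrite Rmult_1_l. destruct (HQ k) as [_ [_ [_ [_ H]]]]. apply H; auto.
    apply (HQ (S k)). auto. }
  exists l. intro k. specialize (Hl k). lra.
Qed.
End ArzelaAscoli.

Lemma sqrt_1_plus_sqr_ge (t : R) : 1 <= sqrt (1 + t ^ 2).
Proof. rewrite <- sqrt_1 at 1. apply sqrt_le_1_alt. simpl. nra. Qed.

Lemma chordal_Some_le (a b : C) : chordal (Some a) (Some b) <= 2 * Cmod (a - b).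
Proof.
  simpl chordal.
  assert (H1 := sqrt_1_plus_sqr_ge (Cmod a)). assert (H2 := sqrt_1_plus_sqr_ge (Cmod b)).
  assert (H : 1 <= sqrt (1 + Cmod a ^ 2) * sqrt (1 + Cmod b ^ 2)).
  { rewrite <- (Rmult_1_l 1) at 1. apply Rmult_le_compat; lra. }
  assert (K := Cmod_ge_0 (a - b)).
  apply Rmult_le_reg_r with (sqrt (1 + Cmod a ^ 2) * sqrt (1 + Cmod b ^ 2)); [lra|].
  unfold Rdiv. rewrite Rmult_assoc, Rinv_l, Rmult_1_r by lra.
  rewrite <- (Rmult_1_r (2 * Cmod (a - b))) at 1. apply Rmult_le_compat_l; lra.
Qed.

Lemma chordal_None_lt (a : C) (eps : R) : 0 < eps -> 2 / eps < Cmod a ->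
  chordal (Some a) None < eps.
Proof.
  intros He Ha. simpl chordal.
  assert (H : Cmod a <= sqrt (1 + Cmod a ^ 2)).
  { rewrite <- (sqrt_pow2 (Cmod a)) at 1 by apply Cmod_ge_0. apply sqrt_le_1_alt. lra. }
  assert (H1 := sqrt_1_plus_sqr_ge (Cmod a)).
  apply Rmult_lt_reg_r with (sqrt (1 + Cmod a ^ 2)); [lra|].
  unfold Rdiv. rewrite Rmult_assoc, Rinv_l, Rmult_1_r by lra.
  apply Rlt_le_trans with (eps * Cmod a); [|apply Rmult_le_compat_l; lra].
  replace 2 with (eps * (2 / eps)) by (field; lra). apply Rmult_lt_compat_l; auto.
Qed.

Lemma strictly_increasing_ge (phi : nat -> nat) : strictly_increasing phi ->
  forall k, (k <= phi k)%nat.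
Proof. intros H k. induction k as [|k IH]; [lia|]. specialize (H k). lia. Qed.

(** Either infinitely many members of the sequence are bounded at the centre, hence uniformly on the
    disc, and Arzela-Ascoli applies; or the values at the centre tend to infinity, and the bounded
    oscillation carries the whole disc along. *)
Lemma equilipschitz_normal {I : Type} (F : I -> C -> C) (x : C) (r K : R) : 0 < r ->
  (forall i a b, Cmod (a - x) < r -> Cmod (b - x) < r ->
    Cmod (F i a - F i b) <= K * Cmod (a - b)) ->
  normal_family (fun w => Cmod (w - x) < r) F.
Proof.
  intros Hr HF m.
  set (U := fun w => Cmod (w - x) < r).
  assert (HUx : U x) by (unfold U; rewrite Cmod_minus_diag; auto).
  assert (Hdist : forall k w, U w -> Cmod (F (m k) w - F (m k) x) <= Rabs K * r).
  { intros k w Hw. eapply Rle_trans; [apply HF; auto|].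
    unfold U in Hw. assert (J := Rle_abs K). assert (J' := Cmod_ge_0 (w - x)).
    assert (J'' := Rabs_pos K). nra. }
  destruct (classic (exists M, infinite (fun k => Cmod (F (m k) x) <= M))) as [[M HM]|Hinf].
  - destruct (arzela_ascoli (fun k => F (m k)) U (Cmod x + r) K (M + Rabs K * r))
      with (P := fun k => Cmod (F (m k) x) <= M) as [phi [h [H1 [_ H3]]]].
    + intros w Hw. assert (J := Cmod_le_dist w x). unfold U in Hw. lra.
    + intros k a b Ha Hb. apply HF; auto.
    + exact HM.
    + intros k Hk w Hw. assert (J := Cmod_le_dist (F (m k) w) (F (m k) x)).
      specialize (Hdist k w Hw). lra.
    + exists phi, (fun w => Some (h w)). split; auto.
      intros z Hz. exists (fun _ => True). split; [apply filter_true|].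
      intro eps.
      destruct (pow_lt_1_zero (1/2)) with (y := eps / 4) as [N HN].
      { rewrite Rabs_pos_eq; lra. }
      { assert (J := cond_pos eps). lra. }
      exists N. intros n Hn w Hw _. specialize (HN n Hn).
      rewrite Rabs_pos_eq in HN by (apply pow_le; lra).
      eapply Rle_lt_trans; [apply chordal_Some_le|].
      specialize (H3 w Hw n). rewrite Cmod_minus_sym in H3. lra.
  - exists (fun k => k), (fun _ => None). split; [intro k; lia|].
    intros z Hz. exists (fun _ => True). split; [apply filter_true|].
    intro eps. assert (He := cond_pos eps).
    assert (Hev : exists N, forall k, (N <= k)%nat -> 2 / eps + Rabs K * r < Cmod (F (m k) x)).
    { apply NNPP. intro Hn. apply Hinf. exists (2 / eps + Rabs K * r). intro n.
      apply NNPP. intro Hn'. apply Hn. exists n. intros k Hk.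
      apply Rnot_le_lt. intro. apply Hn'. eauto. }
    destruct Hev as [N HN]. exists N. intros k Hk w Hw _.
    apply chordal_None_lt; auto. specialize (HN k Hk). specialize (Hdist k w Hw).
    assert (J := Cmod_le_dist (F (m k) x) (F (m k) w)).
    rewrite Cmod_minus_sym in J. lra.
Qed.

Lemma Cmod_ball (x y : C) (e : R) : Cmod (y - x) < e -> @ball C_UniformSpace x e y.
Proof.
  intro H. split; eapply Rle_lt_trans; try exact H.
  - eapply Rle_trans; [|apply re_le_Cmod]. right. destruct x, y; reflexivity.
  - eapply Rle_trans; [|apply Im_le_Cmod]. right. destruct x, y; reflexivity.
Qed.

(** Balls of the product uniform structure are squares, hence the factor 2. *)
Lemma ball_Cmod (x y : C) (e : R) : @ball C_UniformSpace x e y -> Cmod (y - x) < 2 * e.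
Proof.
  intros [H1 H2]. eapply Rle_lt_trans; [apply Cmod_Re_Im_le|].
  destruct x as [a b], y as [c d].
  change (Rabs (c - a) < e) in H1. change (Rabs (d - b) < e) in H2.
  simpl. unfold Rminus in *. lra.
Qed.

Lemma open_Cmod_ball (x : C) (r : R) : @open C_UniformSpace (fun w => Cmod (w - x) < r).
Proof.
  intros w Hw. assert (Hp : 0 < (r - Cmod (w - x)) / 2) by lra.
  exists (mkposreal _ Hp). intros v Hv. apply ball_Cmod in Hv. simpl in Hv.
  eapply Rle_lt_trans; [apply (Cmod_dist_triangle v w x)|]. lra.
Qed.

Lemma equilipschitz_fatou (f : C -> C) (x : C) (r K : R) : 0 < r ->
  (forall n a b, Cmod (a - x) < r -> Cmod (b - x) < r ->
    Cmod (Nat.iter n f a - Nat.iter n f b) <= K * Cmod (a - b)) ->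
  fatou f x.
Proof.
  intros Hr H. exists (fun w => Cmod (w - x) < r). split; [|split].
  - apply open_Cmod_ball.
  - rewrite Cmod_minus_diag. auto.
  - apply equilipschitz_normal with K; auto.
Qed.

Lemma cder_is_derive (f : C -> C) (z l : C) : cder f z l -> C_derive f z = l.
Proof.
  intro H. apply is_C_derive_unique. split.
  - apply is_linear_scal_l.
  - intros x Hx eps.
    assert (E := @is_filter_lim_locally_unique C_AbsRing (AbsRing_NormedModule C_AbsRing) z x Hx).
    subst x.
    destruct (H eps (cond_pos eps)) as [d [Hd H1]].
    exists (mkposreal d Hd). intros y Hyz.
    change (Cmod (y - z) < d) in Hyz.
    change (Cmod (f y - f z - (y - z) * l) <= eps * Cmod (y - z)).
    rewrite (Cmult_comm _ l). exact (H1 y Hyz).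
Qed.

(** * Inverse branches of the exponential family *)

Definition tcont (c : R -> C) (t : R) : Prop :=
  forall eps, 0 < eps -> exists d, 0 < d /\ forall s, Rabs (s - t) < d -> Cmod (c s - c t) < eps.

Lemma tcont_comp f c t : ccont f (c t) -> tcont c t -> tcont (fun s => f (c s)) t.
Proof.
  intros Hf Hc eps Heps. destruct (Hf eps Heps) as [d [Hd H]].
  destruct (Hc d Hd) as [d' [Hd' H']]. exists d'. split; auto.
Qed.

Lemma tcont_segment a b t : tcont (fun s => a + RtoC s * (b - a))%C t.
Proof.
  intros eps Heps. assert (K := Cmod_ge_0 (b - a)).
  exists (eps / (1 + Cmod (b - a))). split; [apply Rdiv_lt_0_compat; lra|].
  intros s Hs.
  replace (a + RtoC s * (b - a) - (a + RtoC t * (b - a)))%C with (RtoC (s - t) * (b - a))%C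
    by (rewrite RtoC_minus; ring).
  rewrite Cmod_mult, Cmod_R.
  assert (J := Rabs_pos (s - t)).
  apply Rle_lt_trans with (Rabs (s - t) * (1 + Cmod (b - a))); [nra|].
  apply Rlt_le_trans with (eps / (1 + Cmod (b - a)) * (1 + Cmod (b - a))).
  - apply Rmult_lt_compat_r; lra.
  - right. field. lra.
Qed.

(** A value of at least 1 at T would force the value 1/2 in between; the same argument applies to
    [- psi]. *)
Lemma integer_valued_constant (psi : R -> R) (T : R) : 0 <= T ->
  (forall t, 0 <= t <= T -> continuity_pt psi t) ->
  (forall t, 0 <= t <= T -> exists k : Z, psi t = IZR k) ->
  psi 0 = 0 -> psi T = 0.
Proof.
  intros HT Hc Hi H0.
  destruct (Rle_lt_or_eq_dec _ _ HT) as [HT0|HT0]; [|rewrite <- HT0; auto].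
  assert (Hhalf : forall k : Z, IZR k <> / 2 /\ IZR k <> - / 2).
  { intro k. split; intro E; assert (E' : IZR (2 * k) = IZR 1 \/ IZR (2 * k) = IZR (-1))
      by (rewrite mult_IZR; simpl; lra); destruct E' as [E'|E']; apply eq_IZR in E'; lia. }
  assert (Hiv : forall chi : R -> R, (forall t, 0 <= t <= T -> continuity_pt chi t) ->
    (forall t, 0 <= t <= T -> exists k : Z, chi t = IZR k) -> chi 0 = 0 -> chi T <= 0).
  { intros chi Cc Ci C0. apply Rnot_lt_le. intro Hp.
    destruct (Ci T ltac:(lra)) as [k Hk].
    assert (Hk1 : 1 <= chi T).
    { rewrite Hk in *. apply (lt_IZR 0) in Hp. apply IZR_le. lia. }
    destruct (Ranalysis5.IVT_interv (fun t => chi t - / 2) 0 T) as [t [Ht E]]; try lra.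
    - intros t Ht. apply (continuity_pt_minus chi (fun _ => / 2)); auto.
      apply continuity_pt_const. intros ? ?. reflexivity.
    - destruct (Ci t Ht) as [j Hj]. destruct (Hhalf j). lra. }
  apply Rle_antisym; [auto|].
  assert (H := Hiv (fun t => - psi t)).
  assert (- psi T <= 0); [|lra]. apply H.
  - intros t Ht. apply (continuity_pt_opp psi). auto.
  - intros t Ht. destruct (Hi t Ht) as [k Hk]. exists (- k)%Z. rewrite opp_IZR. lra.
  - lra.
Qed.

Lemma exists_cder_separated (g : C -> C) (l : C) (c : R) : 0 < c -> cder g (RtoC 0) l ->
  l <> RtoC 0 -> exists u, Cmod u < c /\ 0 < Cmod (g u - g (RtoC 0)).
Proof.
  intros Hc H Hl. assert (Hm : 0 < Cmod l) by (apply Cmod_gt_0; auto).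
  destruct (H (Cmod l / 2)) as [d [Hd H1]]; [lra|].
  set (s := Rmin (c / 2) (d / 2)).
  assert (Hs : 0 < s) by (apply Rmin_pos; lra).
  assert (Hs1 : s <= c / 2) by apply Rmin_l. assert (Hs2 : s <= d / 2) by apply Rmin_r.
  exists (RtoC s). rewrite Cmod_R, Rabs_pos_eq by lra. split; [lra|].
  specialize (H1 (RtoC s)). replace (RtoC s - RtoC 0)%C with (RtoC s) in H1 by ring.
  rewrite Cmod_R, Rabs_pos_eq in H1 by lra. specialize (H1 ltac:(lra)).
  apply Rnot_le_lt. intro Hz.
  assert (E : Cmod (l * RtoC s) <= Cmod (g (RtoC s) - g (RtoC 0)) +
    Cmod (g (RtoC s) - g (RtoC 0) - l * RtoC s)).
  { replace (l * RtoC s)%C with ((g (RtoC s) - g (RtoC 0)) - (g (RtoC s) - g (RtoC 0) - l * RtoC s))%C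
      at 1 by ring. apply Cmod_minus_le. }
  rewrite Cmod_mult, Cmod_R, Rabs_pos_eq in E by lra. nra.
Qed.

Section Exponential.
Variable lam : C.
Hypothesis hlam : lam <> RtoC 0.
Let f : C -> C := flam lam.

Fixpoint Diter (n : nat) (z : C) : C :=
  match n with
  | O => RtoC 1
  | S n => (Diter n (f z) * (lam * f z))%C
  end.

Lemma cder_flam z : cder f z (lam * f z)%C.
Proof.
  unfold f, flam. rewrite Cmult_comm.
  apply (cder_comp Cexp (fun w => lam * w)%C).
  - apply cder_Cexp.
  - assert (E := cder_scal lam _ _ _ (cder_id z)). rewrite Cmult_1_r in E. exact E.
Qed.

Lemma ccont_flam z : ccont f z.
Proof. eapply cder_ccont. apply cder_flam. Qed.

Lemma flam_neq_0 z : f z <> RtoC 0.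
Proof. apply Cexp_neq_0. Qed.

Lemma cder_iter n : forall z, cder (Nat.iter n f) z (Diter n z) /\ ccont (Diter n) z.
Proof.
  induction n as [|n IH]; intro z.
  - split; [apply cder_id|apply ccont_const].
  - split.
    + apply (cder_ext_ball (fun w => Nat.iter n f (f w)) _ z _ 1); [lra| |].
      * intros w _. symmetry. apply Nat.iter_succ_r.
      * apply (cder_comp (Nat.iter n f) f); [apply IH|apply cder_flam].
    + apply (ccont_mult (fun w => Diter n (f w)) (fun w => lam * f w)%C).
      * apply (ccont_comp (Diter n) f); [apply IH|apply ccont_flam].
      * apply ccont_mult; [apply ccont_const|apply ccont_flam].
Qed.

Lemma hol_iter n z r : hol (Nat.iter n f) (Diter n) z r.
Proof. intros w _. apply cder_iter. Qed.

Lemma ccont_iter n z : ccont (Nat.iter n f) z.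
Proof. eapply cder_ccont. apply cder_iter. Qed.

Lemma Diter_add n m : forall z, Diter (m + n) z = (Diter n (Nat.iter m f z) * Diter m z)%C.
Proof.
  induction m as [|m IH]; intro z.
  - simpl. ring.
  - rewrite Nat.iter_succ_r. simpl Diter. rewrite IH. ring.
Qed.

Lemma Diter_succ n z : Diter (S n) z = (lam * Nat.iter (S n) f z * Diter n z)%C.
Proof. replace (S n) with (n + 1)%nat at 1 by lia. rewrite Diter_add. simpl. ring. Qed.

Lemma Diter_neq_0 n : forall z, Diter n z <> RtoC 0.
Proof.
  induction n as [|n IH]; intro z; simpl.
  - intro E. apply RtoC_inj in E. lra.
  - repeat apply Cmult_neq_0; auto. apply flam_neq_0.
Qed.

Lemma flam_eq a b : f a = f b -> exists k : Z, (lam * (a - b))%C = (0, 2 * PI * IZR k).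
Proof.
  intro H. apply Cexp_eq_1.
  replace (lam * (a - b))%C with (lam * a - lam * b)%C by ring.
  rewrite Cexp_minus. change (Cexp (lam * a)) with (f a). change (Cexp (lam * b)) with (f b).
  rewrite H. field. apply flam_neq_0.
Qed.

(** Two points with equal image differ by 2 pi i k / lam, and along the curves the integer k varies
    continuously from 0. *)
Lemma flam_lift_unique (a b : R -> C) (T : R) : 0 <= T ->
  (forall t, 0 <= t <= T -> tcont a t /\ tcont b t /\ f (a t) = f (b t)) ->
  a 0 = b 0 -> a T = b T.
Proof.
  intros HT H H0.
  set (psi := fun t => Im (lam * (a t - b t))%C / (2 * PI)).
  assert (P0 := PI_RGT_0). assert (Hm : 0 < Cmod lam) by (apply Cmod_gt_0; auto).
  assert (Hz : psi T = 0).
  { apply integer_valued_constant; auto.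
    - intros t Ht. destruct (H t Ht) as [Ha [Hb _]]. intros eps Heps.
      set (e := eps * (2 * PI) / (2 * Cmod lam)).
      assert (He : 0 < e) by (apply Rdiv_lt_0_compat; nra).
      destruct (Ha e He) as [d1 [Hd1 H1]]. destruct (Hb e He) as [d2 [Hd2 H2]].
      exists (Rmin d1 d2). split; [apply Rmin_pos; auto|].
      intros s [_ Hs].
      specialize (H1 s (Rlt_le_trans _ _ _ Hs (Rmin_l _ _))).
      specialize (H2 s (Rlt_le_trans _ _ _ Hs (Rmin_r _ _))).
      simpl. unfold R_dist, psi.
      replace (Im (lam * (a s - b s))%C / (2 * PI) - Im (lam * (a t - b t))%C / (2 * PI))
        with (Im (lam * ((a s - a t) - (b s - b t)))%C / (2 * PI)).
      2:{ destruct lam, (a s), (b s), (a t), (b t); simpl. field. lra. }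
      unfold Rdiv. rewrite Rabs_mult, (Rabs_pos_eq (/ (2 * PI)))
        by (left; apply Rinv_0_lt_compat; lra).
      apply Rmult_lt_reg_r with (2 * PI); [lra|].
      rewrite Rmult_assoc, Rinv_l, Rmult_1_r by lra.
      eapply Rle_lt_trans; [apply Im_le_Cmod|]. rewrite Cmod_mult.
      apply Rle_lt_trans with (Cmod lam * (Cmod (a s - a t) + Cmod (b s - b t))).
      { apply Rmult_le_compat_l; [lra|apply Cmod_minus_le]. }
      replace (eps * (2 * PI)) with (Cmod lam * (2 * e)) by (unfold e; field; lra).
      apply Rmult_lt_compat_l; lra.
    - intros t Ht. destruct (H t Ht) as [_ [_ E]]. apply flam_eq in E. destruct E as [k Hk].
      exists k. unfold psi. rewrite Hk. simpl. field. lra.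
    - unfold psi. rewrite H0. replace (lam * (b 0 - b 0))%C with (RtoC 0) by ring. simpl. lra. }
  destruct (H T ltac:(lra)) as [_ [_ E]]. apply flam_eq in E. destruct E as [k Hk].
  unfold psi in Hz. rewrite Hk in Hz. simpl in Hz.
  assert (Ez : (lam * (a T - b T))%C = RtoC 0).
  { rewrite Hk. unfold RtoC. f_equal. apply Rmult_eq_reg_r with (/ (2 * PI)); [|apply Rinv_neq_0_compat; lra].
    rewrite Rmult_0_l. exact Hz. }
  replace (a T) with (/ lam * (lam * (a T - b T)) + b T)%C by (field; auto).
  rewrite Ez. ring.
Qed.

(** The outermost exponential is stripped first: the images of [a] and [b] under f^n are two lifts
    of one curve with the same start. Equality is needed at every t, hence the free endpoint in
    [flam_lift_unique]. *)
Lemma iter_lift_unique n : forall a b : R -> C,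
  (forall t, 0 <= t <= 1 -> tcont a t /\ tcont b t /\ Nat.iter n f (a t) = Nat.iter n f (b t)) ->
  a 0 = b 0 -> a 1 = b 1.
Proof.
  induction n as [|n IH]; intros a b H H0.
  - apply (H 1). lra.
  - apply IH; auto. intros t Ht. destruct (H t Ht) as [Ha [Hb _]].
    split; [auto|split; [auto|]].
    apply (flam_lift_unique (fun t => Nat.iter n f (a t)) (fun t => Nat.iter n f (b t)) t); [lra| |rewrite H0; auto].
    intros s Hs. destruct (H s ltac:(lra)) as [Ha' [Hb' E]].
    split; [|split; [|exact E]]; apply (tcont_comp (Nat.iter n f)); auto; apply ccont_iter.
Qed.

Definition injective_on_ball (g : C -> C) (x : C) (r : R) : Prop :=
  forall v w, Cmod (v - x) < r -> Cmod (w - x) < r -> g v = g w -> v = w.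

(* Koebe for [f^(n+1)], whose derivative is [lam * f^(n+1)] times that of [f^n], bounds the
   latter by a constant. *)
Lemma iterates_injective_fatou x r : 0 < r ->
  (forall n, injective_on_ball (Nat.iter n f) x r) -> fatou f x.
Proof.
  intros Hr Hinj. assert (Hm : 0 < Cmod lam) by (apply Cmod_gt_0; auto).
  apply equilipschitz_fatou with (r / 2) (8192 / (Cmod lam * r)); [lra|].
  intros n a b Ha Hb.
  apply (MVT_ball (Nat.iter n f) (Diter n) x (r / 2)); auto.
  - intros w _. apply cder_iter.
  - intros w Hw.
    assert (Hsub : forall v, Cmod (v - w) < r / 2 -> Cmod (v - x) < r).
    { intros v Hv. eapply Rle_lt_trans; [apply (Cmod_dist_triangle v w x)|]. lra. }
    assert (H := koebe (Nat.iter (S n) f) (Diter (S n)) w (r / 2) ltac:(lra) (hol_iter _ _ _)).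
    rewrite Diter_succ, !Cmod_mult in H.
    assert (Hp : 0 < Cmod (Nat.iter (S n) f w)) by (apply Cmod_gt_0, flam_neq_0).
    assert (H' : Cmod lam * Cmod (Nat.iter (S n) f w) * Cmod (Diter n w) * (r / 2)
      <= 4096 * Cmod (Nat.iter (S n) f w)).
    { apply H.
      - intros v _. apply flam_neq_0.
      - intros v u Hv Hu E. apply (Hinj (S n)); auto. }
    apply Rmult_le_reg_r with (Cmod lam * r / 2 * Cmod (Nat.iter (S n) f w)); [apply Rmult_lt_0_compat; nra|].
    apply Rle_trans with (4096 * Cmod (Nat.iter (S n) f w)).
    + eapply Rle_trans; [|exact H']. right. field.
    + right. field. lra.
Qed.

(** The branch on the disc around y that sends y back to x. The derivative relation is carried along
    as a product, so that it passes through a lift without division. *)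
Definition inverse_branch (n : nat) (x y : C) (r : R) (h h' : C -> C) : Prop :=
  hol h h' y r /\ h y = x /\
  forall z, Cmod (z - y) < r -> Nat.iter n f (h z) = z /\ (h' z * Diter n (h z) = RtoC 1)%C.

Lemma inverse_branch_injective n x y r h h' : inverse_branch n x y r h h' ->
  injective_on_ball h y r.
Proof.
  intros [_ [_ H]] v w Hv Hw E.
  rewrite <- (proj1 (H v Hv)), <- (proj1 (H w Hw)), E. reflexivity.
Qed.

(** The segment from s to p lies in both discs, and along it the two branches lift the same curve
    through f^n. *)
Lemma inverse_branch_agree n x1 y1 r1 h1 h1' x2 y2 r2 h2 h2' s p :
  inverse_branch n x1 y1 r1 h1 h1' -> inverse_branch n x2 y2 r2 h2 h2' ->
  Cmod (s - y1) < r1 -> Cmod (s - y2) < r2 -> h1 s = h2 s ->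
  Cmod (p - y1) < r1 -> Cmod (p - y2) < r2 -> h1 p = h2 p.
Proof.
  intros [Hh1 [_ H1]] [Hh2 [_ H2]] Hs1 Hs2 E Hp1 Hp2.
  assert (K := iter_lift_unique n (fun t => h1 (s + RtoC t * (p - s))%C)
    (fun t => h2 (s + RtoC t * (p - s))%C)). simpl in K.
  replace (s + RtoC 1 * (p - s))%C with p in K by ring.
  replace (s + RtoC 0 * (p - s))%C with s in K by ring.
  apply K; auto. intros t Ht.
  assert (I1 := segment_ball y1 s p r1 t Hs1 Hp1 Ht).
  assert (I2 := segment_ball y2 s p r2 t Hs2 Hp2 Ht).
  split; [|split].
  - apply (tcont_comp h1); [eapply cder_ccont; apply Hh1; auto|apply tcont_segment].
  - apply (tcont_comp h2); [eapply cder_ccont; apply Hh2; auto|apply tcont_segment].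
  - rewrite (proj1 (H1 _ I1)), (proj1 (H2 _ I2)). reflexivity.
Qed.

(** [koebe] for h - a, which is injective and has no zero. *)
Lemma inverse_branch_koebe n x y r h h' a z d : 0 < d -> Cmod (z - y) + d <= r ->
  inverse_branch n x y r h h' ->
  (forall w, Cmod (w - y) < r -> h w <> a) ->
  Cmod (h' z) * d <= 4096 * Cmod (h z - a).
Proof.
  intros Hd Hr Hb Ha.
  assert (Hsub : forall v, Cmod (v - z) < d -> Cmod (v - y) < r).
  { intros v Hv. eapply Rle_lt_trans; [apply (Cmod_dist_triangle v z y)|]. lra. }
  apply (koebe (fun w => h w - a)%C h'); auto.
  - intros w Hw. destruct (proj1 Hb w (Hsub w Hw)) as [H1 H2]. split; auto.
    replace (h' w) with (h' w - RtoC 0)%C by ring. apply cder_minus; auto. apply cder_const.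
  - intros w Hw E. apply (Ha w (Hsub w Hw)).
    replace (h w) with (h w - a + a)%C by ring. rewrite E. ring.
  - intros v w Hv Hw E. apply (inverse_branch_injective _ _ _ _ _ _ Hb); auto.
    replace (h v) with (h v - a + a)%C by ring. rewrite E. ring.
Qed.

(** On the closed half disc the logarithmic derivative of h - a is at most 8192/r; integrated over a
    length of at most r/2 this gives the exponent 4096. *)
Lemma inverse_branch_growth n x y r h h' a p q : 0 < r ->
  inverse_branch n x y r h h' ->
  (forall w, Cmod (w - y) < r -> h w <> a) ->
  Cmod (p - y) <= r / 2 -> Cmod (q - y) <= r / 2 -> Cmod (q - p) <= r / 2 ->
  Cmod (h q - a) <= exp 4096 * Cmod (h p - a).
Proof.
  intros Hr Hb Ha Hp Hq Hpq.
  eapply Rle_trans.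
  - apply (gronwall_segment (fun w => h w - a)%C h' (8192 / r) p q).
    + left. apply Rdiv_lt_0_compat; lra.
    + intros t Ht. set (v := (p + RtoC t * (q - p))%C).
      assert (Hv : Cmod (v - y) <= r / 2).
      { apply Rle_plus_epsilon. intros eps Heps. left. apply segment_ball; lra. }
      split.
      * replace (h' v) with (h' v - RtoC 0)%C by ring.
        apply cder_minus; [apply Hb; lra|apply cder_const].
      * assert (K := inverse_branch_koebe n x y r h h' a v (r / 2) ltac:(lra) ltac:(lra) Hb Ha).
        apply Rmult_le_reg_r with (r / 2); [lra|].
        eapply Rle_trans; [exact K|]. right. field. lra.
  - apply Rmult_le_compat_r; [apply Cmod_ge_0|].
    assert (E : 8192 / r * Cmod (q - p) <= 4096).
    { apply Rle_trans with (8192 / r * (r / 2)).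
      - apply Rmult_le_compat_l; auto. left. apply Rdiv_lt_0_compat; lra.
      - right. field. lra. }
    destruct E as [E|E]; [left; apply exp_increasing; auto|rewrite E; lra].
Qed.

(** The new branch is x + log(h / f x) / lam. The radius shrinks because Koebe bounds the
    logarithmic derivative of [h] uniformly only at a fixed distance from the boundary. *)
Lemma inverse_branch_lift n x y r r1 h h' : 0 < r1 < r ->
  inverse_branch n (f x) y r h h' ->
  (forall w, Cmod (w - y) < r -> h w <> RtoC 0) ->
  exists g g', inverse_branch (S n) x y r1 g g'.
Proof.
  intros Hr Hb Hnz. assert (Hb' := Hb). destruct Hb' as [Hh [Hy Hz]].
  destruct (log_exists h h' y r1 (4096 / (r - r1))) as [L [HL0 [HLe HLh]]].
  - lra.
  - left. apply Rdiv_lt_0_compat; lra.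
  - intros w Hw. apply Hh. lra.
  - intros w Hw. apply Hnz. lra.
  - intros w Hw.
    assert (K := inverse_branch_koebe n _ y r h h' (RtoC 0) w (r - r1) ltac:(lra) ltac:(lra) Hb Hnz).
    replace (h w - RtoC 0)%C with (h w) in K by ring.
    apply Rmult_le_reg_r with (r - r1); [lra|].
    eapply Rle_trans; [exact K|]. right. field. lra.
  - exists (fun w => / lam * L w + x)%C, (fun w => / lam * (h' w / h w))%C.
    assert (Hnx : f x <> RtoC 0) by apply flam_neq_0.
    assert (Hf : forall w, Cmod (w - y) < r1 -> f (/ lam * L w + x)%C = h w).
    { intros w Hw. unfold f, flam.
      replace (lam * (/ lam * L w + x))%C with (L w + lam * x)%C by (field; auto).
      rewrite Cexp_plus, HLe, Hy by auto. change (Cexp (lam * x)) with (f x). field. auto. }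
    split; [|split].
    + intros w Hw. destruct (HLh w Hw) as [H1 H2]. split.
      * replace (/ lam * (h' w / h w))%C with (/ lam * (h' w / h w) + RtoC 0)%C by ring.
        apply cder_plus; [apply cder_scal; auto|apply cder_const].
      * apply ccont_mult; auto. apply ccont_const.
    + rewrite HL0. ring.
    + intros w Hw. destruct (Hz w ltac:(lra)) as [H1 H2].
      assert (Hn := Hnz w ltac:(lra)). split.
      * rewrite Nat.iter_succ_r, Hf; auto.
      * simpl Diter. rewrite Hf by auto. rewrite <- H2. field. auto.
Qed.

Lemma inverse_branch_injective_iter n x y r h h' c : inverse_branch n x y r h h' ->
  (forall a, Cmod (a - x) < c -> exists p, Cmod (p - y) < r /\ h p = a) ->
  injective_on_ball (Nat.iter n f) x c.
Proof.
  intros [_ [_ H]] Hs v w Hv Hw E.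
  destruct (Hs v Hv) as [p [Hp <-]]. destruct (Hs w Hw) as [q [Hq <-]].
  rewrite (proj1 (H p Hp)), (proj1 (H q Hq)) in E. subst. reflexivity.
Qed.

(** * Branches of fixed radius and derivative growth along orbits that stay away from 0 *)

Variable del : R.
Hypothesis Hdel : 0 < del.
(** Time 0 is left out so that the singular point 0 can itself satisfy this. *)
Definition avoids (x : C) : Prop := forall n, (1 <= n)%nat -> del <= Cmod (Nat.iter n f x).
Hypothesis H0 : avoids (RtoC 0).
Hypothesis HJ : forall z, ~ fatou f z.

Lemma avoids_flam x : avoids x -> avoids (f x).
Proof. intros H n Hn. rewrite <- Nat.iter_succ_r. apply H. lia. Qed.

(* If [a] with [|a| < c0] were omitted, two growth estimates would give
   [|x| <= |a| + exp 4096 ^ 2 * |a| < del]. *)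
Let c0 : R := del / (1 + exp 4096 * exp 4096).

Lemma c0_pos : 0 < c0.
Proof. apply Rdiv_lt_0_compat; auto. assert (K := exp_pos 4096). nra. Qed.

(** Both branches take the value 0 at s, so they agree on the overlap of their discs and glue to one
    inverse of f^n. Every point of the disc of radius [c0] is a value of the glued branch; so f^n is
    injective there with image in the union of the two discs, within 2r of s. *)
Lemma two_branches n x y r h h' s h2 h2' : 0 < r -> del <= Cmod x ->
  inverse_branch n x y r h h' -> Cmod (s - y) < r -> h s = RtoC 0 ->
  inverse_branch n (RtoC 0) s r h2 h2' ->
  injective_on_ball (Nat.iter n f) (RtoC 0) c0 /\
  forall u, Cmod (u - RtoC 0) < c0 -> Cmod (Nat.iter n f u - Nat.iter n f (RtoC 0)) < 2 * r.
Proof.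
  intros Hr Hx Hb Hsy Hs Hb2.
  assert (Hss : Cmod (s - s) < r) by (rewrite Cmod_minus_diag; auto).
  assert (Hyy : Cmod (y - y) < r) by (rewrite Cmod_minus_diag; auto).
  assert (Hs2 : h2 s = RtoC 0) by apply Hb2.
  assert (Hagree : forall p, Cmod (p - y) < r -> Cmod (p - s) < r -> h p = h2 p).
  { intros p Hp1 Hp2. eapply (inverse_branch_agree _ _ _ _ _ _ _ _ _ _ _ s p Hb Hb2); auto.
    congruence. }
  assert (Hcover : forall a, Cmod (a - RtoC 0) < c0 ->
    (exists p, Cmod (p - y) < r /\ h p = a) \/ (exists p, Cmod (p - s) < r /\ h2 p = a)).
  { intros a Ha. apply NNPP. intro Hn.
    assert (N1 : forall w, Cmod (w - y) < r -> h w <> a) by (intros w Hw E; apply Hn; eauto).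
    assert (N2 : forall w, Cmod (w - s) < r -> h2 w <> a) by (intros w Hw E; apply Hn; eauto).
    (* The midpoint lies in the half discs of both branches, where they coincide. Going from s to m
       with [h2] and from m to y with [h] costs one factor exp 4096 each. *)
    set (m := ((s + y) / RtoC 2)%C).
    assert (T2 : RtoC 2 <> RtoC 0) by (intro E; apply RtoC_inj in E; lra).
    assert (Hms : Cmod (m - s) <= r / 2).
    { replace (m - s)%C with (- ((s - y) / RtoC 2))%C by (unfold m; field; auto).
      rewrite Cmod_opp, Cmod_div, Cmod_R, Rabs_pos_eq by (auto; lra). lra. }
    assert (Hmy : Cmod (m - y) <= r / 2).
    { replace (m - y)%C with ((s - y) / RtoC 2)%C by (unfold m; field; auto).
      rewrite Cmod_div, Cmod_R, Rabs_pos_eq by (auto; lra). lra. }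
    assert (G2 := inverse_branch_growth _ _ _ _ _ _ a s m Hr Hb2 N2
      ltac:(rewrite Cmod_minus_diag; lra) Hms Hms).
    assert (G1 := inverse_branch_growth _ _ _ _ _ _ a m y Hr Hb N1
      Hmy ltac:(rewrite Cmod_minus_diag; lra) ltac:(rewrite Cmod_minus_sym; auto)).
    rewrite (Hagree m) in G1 by lra. rewrite Hs2 in G2.
    replace (h y) with x in G1 by (symmetry; apply Hb).
    replace (a - RtoC 0)%C with a in Ha by ring.
    replace (Cmod (RtoC 0 - a)) with (Cmod a) in G2
      by (rewrite <- (Cmod_opp a); f_equal; ring).
    assert (K := exp_pos 4096). assert (J := Cmod_le_dist x a).
    set (e := exp 4096) in *.
    assert (Cmod (x - a) <= e * (e * Cmod a)).
    { eapply Rle_trans; [exact G1|]. apply Rmult_le_compat_l; lra. }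
    assert (Cmod a * (1 + e * e) < c0 * (1 + e * e)) by (apply Rmult_lt_compat_r; nra).
    assert (c0 * (1 + e * e) = del) by (unfold c0; fold e; field; nra).
    lra. }
  assert (Hiter : forall p u, (Cmod (p - y) < r /\ h p = u) \/ (Cmod (p - s) < r /\ h2 p = u) ->
    Nat.iter n f u = p).
  { intros p u [[Hp <-]|[Hp <-]]; [apply Hb|apply Hb2]; auto. }
  assert (Hf0 : Nat.iter n f (RtoC 0) = s) by (rewrite <- Hs2; apply Hb2; auto).
  split.
  - intros v w Hv Hw E.
    assert (Ep : forall u, Cmod (u - RtoC 0) < c0 -> exists p,
      (Cmod (p - y) < r /\ h p = u) \/ (Cmod (p - s) < r /\ h2 p = u)).
    { intros u Hu. destruct (Hcover u Hu) as [[p Hp]|[p Hp]]; eauto. }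
    destruct (Ep v Hv) as [p Hp]. destruct (Ep w Hw) as [q Hq].
    assert (Epq : p = q) by (rewrite <- (Hiter p v Hp), <- (Hiter q w Hq); auto).
    subst q.
    destruct Hp as [[Hp1 <-]|[Hp1 <-]], Hq as [[Hq1 <-]|[Hq1 <-]]; auto.
    symmetry. auto.
  - intros u Hu. rewrite Hf0.
    destruct (Hcover u Hu) as [[p [Hp Hpu]]|[p [Hp Hpu]]].
    + rewrite (Hiter p u); auto.
      eapply Rle_lt_trans; [apply (Cmod_dist_triangle p y s)|].
      rewrite (Cmod_minus_sym y). lra.
    + rewrite (Hiter p u); auto. lra.
Qed.

(** As [c0] is already fixed, one M with f^M not injective on that disc settles all n >= M. Below M,
    rho is taken so small that some point of the disc has its image at distance at least 2 rho from
    that of 0. *)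
Lemma exists_scale : exists rho, 0 < rho /\ forall n,
  ~ (injective_on_ball (Nat.iter n f) (RtoC 0) c0 /\
     forall u, Cmod (u - RtoC 0) < c0 ->
       Cmod (Nat.iter n f u - Nat.iter n f (RtoC 0)) < 2 * rho).
Proof.
  assert (Hc := c0_pos).
  assert (HM : exists M, ~ injective_on_ball (Nat.iter M f) (RtoC 0) c0).
  { apply not_all_ex_not. intro H. apply (HJ (RtoC 0)).
    apply iterates_injective_fatou with c0; auto. }
  destruct HM as [M HM].
  assert (Hfin : forall N, exists rho, 0 < rho /\ forall n, (n < N)%nat ->
    exists u, Cmod u < c0 /\ 2 * rho <= Cmod (Nat.iter n f u - Nat.iter n f (RtoC 0))).
  { induction N as [|N [rho [Hr IH]]].
    - exists 1. split; [lra|]. intros n Hn. lia.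
    - destruct (exists_cder_separated (Nat.iter N f) (Diter N (RtoC 0)) c0 Hc) as [u [Hu1 Hu2]].
      { apply cder_iter. }
      { apply Diter_neq_0. }
      set (d := Cmod (Nat.iter N f u - Nat.iter N f (RtoC 0))) in *.
      assert (M1 := Rmin_l rho (d / 2)). assert (M2 := Rmin_r rho (d / 2)).
      exists (Rmin rho (d / 2)). split; [apply Rmin_pos; lra|].
      intros n Hn. destruct (Nat.eq_dec n N) as [->|Hne].
      + exists u. split; auto. fold d. lra.
      + destruct (IH n ltac:(lia)) as [v [Hv1 Hv2]]. exists v. split; auto. lra. }
  destruct (Hfin M) as [rho [Hr H]]. exists rho. split; auto.
  intros n [Hi Hd]. destruct (Nat.lt_ge_cases n M) as [Hn|Hn].
  - destruct (H n Hn) as [u [Hu1 Hu2]]. specialize (Hd u).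
    replace (u - RtoC 0)%C with u in Hd by ring. specialize (Hd Hu1). lra.
  - apply HM. intros v w Hv Hw E. apply Hi; auto.
    replace n with ((n - M) + M)%nat by lia. rewrite !Nat.iter_add, E. reflexivity.
Qed.

Lemma inverse_branches_exist : exists rho, 0 < rho /\ forall n x, avoids x ->
  exists h h', inverse_branch n x (Nat.iter n f x) rho h h'.
Proof.
  destruct exists_scale as [rho [Hrho Hno]].
  (* Each lift through the exponential costs a little of the radius. *)
  set (r := fun n : nat => rho * (1 / 2 + / (INR n + 2))).
  assert (Hinv : forall n : nat, 0 < / (INR n + 2) <= 1 / 2).
  { intro n. assert (K := pos_INR n). split; [apply Rinv_0_lt_compat; lra|].
    unfold Rdiv. rewrite Rmult_1_l. apply Rinv_le_contravar; lra. }
  assert (Hr : forall n, rho / 2 < r n <= rho).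
  { intro n. specialize (Hinv n). unfold r. split; nra. }
  assert (Hrdec : forall n, r (S n) < r n).
  { intro n. unfold r. apply Rmult_lt_compat_l; auto. apply Rplus_lt_compat_l.
    rewrite S_INR. assert (K := pos_INR n). apply Rinv_lt_contravar; nra. }
  assert (H : forall n x, avoids x -> exists h h', inverse_branch n x (Nat.iter n f x) (r n) h h').
  { induction n as [|n IH]; intros x Hx.
    - exists (fun w => w), (fun _ => RtoC 1). split; [|split].
      + intros w _. split; [apply cder_id|apply ccont_const].
      + reflexivity.
      + intros z _. split; [reflexivity|simpl; ring].
    - rewrite Nat.iter_succ_r.
      destruct (IH (f x) (avoids_flam x Hx)) as [h [h' Hb]].
      assert (Hrn := Hr n). assert (HrSn := Hr (S n)).
      destruct (classic (exists s, Cmod (s - Nat.iter n f (f x)) < r n /\ h s = RtoC 0))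
        as [[s [Hs1 Hs2]]|Hn0].
      + exfalso. apply (Hno n).
        assert (Es : Nat.iter n f (RtoC 0) = s) by (rewrite <- Hs2; apply Hb; auto).
        (* The induction covers all admissible starting points at once, so it also supplies the
           branch along the orbit of 0, of the same order and radius. *)
        destruct (IH (RtoC 0) H0) as [h2 [h2' Hb2]]. rewrite Es in Hb2.
        destruct (two_branches n (f x) (Nat.iter n f (f x)) (r n) h h' s h2 h2') as [T1 T2]; auto; [lra|exact (Hx 1%nat (le_n _))|].
        split; auto. intros u Hu. specialize (T2 u Hu). lra.
      + apply (inverse_branch_lift n x (Nat.iter n f (f x)) (r n) (r (S n)) h h'); auto.
        * specialize (Hrdec n). lra.
        * intros w Hw E. apply Hn0. eauto. }
  exists (rho / 2). split; [lra|]. intros n x Hx.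
  destruct (H n x Hx) as [h [h' [H1 [H2 H3]]]]. exists h, h'. specialize (Hr n).
  split; [|split]; auto.
  - intros w Hw. apply H1. lra.
  - intros z Hz. apply H3. lra.
Qed.

Lemma derivatives_unbounded x : avoids x -> forall B, exists n, B < Cmod (Diter n x).
Proof.
  intros Hx B. apply NNPP. intro Hn.
  assert (HB : forall n, Cmod (Diter n x) <= B).
  { intro n. apply Rnot_lt_le. intro K. apply Hn. eauto. }
  assert (HB0 : 0 < B).
  { eapply Rlt_le_trans; [|apply (HB 0%nat)]. simpl. rewrite Cmod_1. lra. }
  destruct inverse_branches_exist as [rho [Hrho Hbr]].
  (* The covering form of Koebe: a value omitted by [h] is at distance at least rho |h'| / 4096 from
     x, and |h'| >= 1/B. So [h] covers this disc and f^n is injective on it. *)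
  apply (HJ x). apply iterates_injective_fatou with (rho / (4096 * B)).
  { apply Rdiv_lt_0_compat; lra. }
  intro n. destruct (Hbr n x Hx) as [h [h' Hb]].
  apply (inverse_branch_injective_iter n x _ rho h h' _ Hb).
  intros a Ha. apply NNPP. intro Hna.
  assert (K := inverse_branch_koebe n x _ rho h h' a (Nat.iter n f x) rho Hrho
    ltac:(rewrite Cmod_minus_diag; lra) Hb ltac:(intros w Hw E; apply Hna; eauto)).
  destruct Hb as [_ [Hy Hz]]. rewrite Hy in K.
  destruct (Hz (Nat.iter n f x)) as [_ E]; [rewrite Cmod_minus_diag; auto|].
  rewrite Hy in E. apply (f_equal Cmod) in E. rewrite Cmod_mult, Cmod_1 in E.
  specialize (HB n).
  assert (Hh := Cmod_ge_0 (h' (Nat.iter n f x))).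
  assert (Hone : 1 <= Cmod (h' (Nat.iter n f x)) * B)
    by (rewrite <- E; apply Rmult_le_compat_l; auto).
  rewrite Cmod_minus_sym in Ha.
  assert (Hlt : 4096 * B * Cmod (x - a) < rho).
  { apply Rlt_le_trans with (4096 * B * (rho / (4096 * B))).
    - apply Rmult_lt_compat_l; lra.
    - right. field. lra. }
  assert (rho * 1 <= rho * (Cmod (h' (Nat.iter n f x)) * B)) by (apply Rmult_le_compat_l; lra).
  nra.
Qed.

Lemma derivatives_unbounded_tail x : avoids x -> forall B N, exists n, (N < n)%nat /\ B < Cmod (Diter n x).
Proof.
  intros Hx B N.
  assert (Hb : exists B', forall n, (n <= N)%nat -> Cmod (Diter n x) <= B').
  { induction N as [|N [B' IH]].
    - exists (Cmod (Diter 0 x)). intros n Hn. replace n with 0%nat by lia. lra.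
    - exists (Rmax B' (Cmod (Diter (S N) x))). intros n Hn.
      destruct (Nat.eq_dec n (S N)) as [->|Hne]; [apply Rmax_r|].
      eapply Rle_trans; [apply IH; lia|apply Rmax_l]. }
  destruct Hb as [B' HB'].
  destruct (derivatives_unbounded x Hx (Rmax B B')) as [n Hn].
  assert (M1 := Rmax_l B B'). assert (M2 := Rmax_r B B').
  exists n. split; [|lra].
  destruct (Nat.le_gt_cases n N) as [Hle|]; auto. specialize (HB' n Hle). lra.
Qed.

Lemma uniform_doubling (M : R) : (forall n, Cmod (Nat.iter n f (RtoC 0)) <= M) ->
  exists N, forall j, exists n, (1 <= n <= N)%nat /\ 2 <= Cmod (Diter n (Nat.iter j f (RtoC 0))).
Proof.
  intro HM. apply NNPP. intro Hno.
  assert (Hbad : forall N, exists j, forall n, (n <= N)%nat ->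
    Cmod (Diter n (Nat.iter j f (RtoC 0))) < 2).
  { intro N. apply NNPP. intro Hn. apply Hno. exists N. intro j.
    apply NNPP. intro Hn2. apply Hn. exists j. intros n Hn'.
    apply Rnot_le_lt. intro K. apply Hn2. exists n. split; auto.
    (* At time 0 the derivative is 1, so a time with derivative at least 2 is positive. *)
    destruct n; [|lia]. simpl in K. rewrite Cmod_1 in K. lra. }
  set (j := fun N => epsilon (inhabits O) (fun j => forall n, (n <= N)%nat ->
    Cmod (Diter n (Nat.iter j f (RtoC 0))) < 2)).
  assert (Hj : forall N n, (n <= N)%nat -> Cmod (Diter n (Nat.iter (j N) f (RtoC 0))) < 2).
  { intro N. apply (epsilon_spec (inhabits O) (fun j => forall n, (n <= N)%nat ->
      Cmod (Diter n (Nat.iter j f (RtoC 0))) < 2)). auto. }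
  (* Over a one-point domain Arzela-Ascoli is Bolzano-Weierstrass: the bad orbit points have a
     convergent subsequence. *)
  destruct (arzela_ascoli (fun N _ => Nat.iter (j N) f (RtoC 0)) (fun w => w = RtoC 0) 0 0 M)
    with (P := fun _ : nat => True) as [phi [l [Hphi [_ Hl]]]].
  - intros w ->. rewrite Cmod_0. lra.
  - intros. rewrite Cmod_minus_diag. lra.
  - intro n. exists n. auto.
  - auto.
  - set (x := l (RtoC 0)). specialize (Hl (RtoC 0) eq_refl). fold x in Hl.
    set (u := fun k => Nat.iter (j (phi k)) f (RtoC 0)) in *.
    assert (Hnear : forall d, 0 < d -> forall K, exists k, (K <= k)%nat /\ Cmod (u k - x) < d).
    { intros d Hd K.
      destruct (pow_lt_1_zero (1/2)) with (y := d / 2) as [N HN].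
      { rewrite Rabs_pos_eq; lra. } { lra. }
      exists (N + K)%nat. split; [lia|]. specialize (HN (N + K)%nat ltac:(lia)).
      rewrite Rabs_pos_eq in HN by (apply pow_le; lra).
      rewrite Cmod_minus_sym. specialize (Hl (N + K)%nat). fold (u (N + K)%nat) in Hl. lra. }
    (* Staying away from 0 is a closed condition, so the limit inherits it although it need not lie
       on the orbit of 0. *)
    assert (Hx : avoids x).
    { intros n Hn. apply le_epsilon. intros eps Heps.
      destruct (ccont_iter n x eps Heps) as [d [Hd H]].
      destruct (Hnear d Hd 0%nat) as [k [_ Hk]]. specialize (H _ Hk).
      assert (K := Cmod_le_dist (Nat.iter n f (u k)) (Nat.iter n f x)).
      assert (K' : del <= Cmod (Nat.iter n f (u k))).
      { unfold u. rewrite <- Nat.iter_add. apply H0. lia. }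
      lra. }
    (* The bound 3 leaves a margin of 1 for passing from x to a nearby bad point, where the
       derivative is below 2. *)
    destruct (derivatives_unbounded x Hx 3) as [n Hn].
    destruct (proj2 (cder_iter n x) 1 Rlt_0_1) as [d [Hd H]].
    destruct (Hnear d Hd n) as [k [Hkn Hk]]. specialize (H _ Hk).
    assert (K := Cmod_le_dist (Diter n x) (Diter n (u k))).
    rewrite Cmod_minus_sym in K.
    assert (K' : Cmod (Diter n (u k)) < 2).
    { apply Hj. assert (J := strictly_increasing_ge phi Hphi k). lia. }
    lra.
Qed.

Lemma Diter_lower x : avoids x -> forall n,
  Rmin 1 (Cmod lam * del) ^ n <= Cmod (Diter n x).
Proof.
  intros Hx n. revert x Hx. induction n as [|n IH]; intros x Hx; simpl.
  - rewrite Cmod_1. lra.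
  - rewrite !Cmod_mult, Rmult_comm.
    assert (Hm : 0 < Cmod lam) by (apply Cmod_gt_0; auto).
    assert (Hq : 0 < Rmin 1 (Cmod lam * del)) by (apply Rmin_pos; nra).
    apply Rmult_le_compat.
    + apply pow_le. lra.
    + lra.
    + apply IH, avoids_flam, Hx.
    + eapply Rle_trans; [apply Rmin_r|]. apply Rmult_le_compat_l; [lra|].
      exact (Hx 1%nat (le_n _)).
Qed.

Lemma avoids_iter j : avoids (Nat.iter j f (RtoC 0)).
Proof. intros n Hn. rewrite <- Nat.iter_add. apply H0. lia. Qed.

(** The orbit is cut into blocks of at most N steps, each at least doubling the derivative; hence q
    = 2^(1/N). The incomplete last block is controlled by the crude bound of [Diter_lower]. *)
Lemma exponential_growth (M : R) : (forall n, Cmod (Nat.iter n f (RtoC 0)) <= M) ->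
  exists c q, 0 < c /\ 1 < q /\ forall n, c * q ^ n <= Cmod (Diter n (RtoC 0)).
Proof.
  intro HM. destruct (uniform_doubling M HM) as [N HN].
  assert (HN0 : (1 <= N)%nat) by (destruct (HN 0%nat) as [n [Hn _]]; lia).
  assert (HNR : 0 < INR N) by (apply lt_0_INR; lia).
  set (q := exp (ln 2 / INR N)).
  assert (Hln : 0 < ln 2) by (rewrite <- ln_1; apply ln_increasing; lra).
  assert (Hlq : 0 < ln 2 / INR N) by (apply Rdiv_lt_0_compat; auto).
  assert (Hq : 1 < q) by (unfold q; rewrite <- exp_0; apply exp_increasing; auto).
  assert (HqN : q ^ N = 2).
  { unfold q.
    assert (E : forall k, exp (ln 2 / INR N) ^ k = exp (INR k * (ln 2 / INR N))).
    { induction k as [|k IH]; [simpl; rewrite Rmult_0_l, exp_0; auto|].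
      rewrite S_INR. simpl pow. rewrite IH, <- exp_plus. f_equal. ring. }
    rewrite E. replace (INR N * (ln 2 / INR N)) with (ln 2) by (field; lra). apply exp_ln. lra. }
  assert (Hqk : forall k, (k <= N)%nat -> q ^ k <= 2).
  { intros k Hk. rewrite <- HqN. apply Rle_pow; auto; lra. }
  set (m0 := Rmin 1 (Cmod lam * del)).
  assert (Hlam : 0 < Cmod lam) by (apply Cmod_gt_0; auto).
  assert (Hm0 : 0 < m0 <= 1) by (split; [apply Rmin_pos; nra|apply Rmin_l]).
  set (m := m0 ^ N). assert (Hm : 0 < m) by (apply pow_lt; lra).
  assert (Hmk : forall k, (k <= N)%nat -> m <= m0 ^ k).
  { intros k Hk. unfold m. replace N with (k + (N - k))%nat by lia. rewrite pow_add.
    rewrite <- (Rmult_1_r (m0 ^ k)) at 2. apply Rmult_le_compat_l; [apply pow_le; lra|].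
    rewrite <- (pow1 (N - k)). apply pow_incr. lra. }
  (* For at most N steps the derivative is at least m while q^i <= 2, which is where m/2 comes
     from. *)
  exists (m / 2), q. split; [lra|]. split; auto.
  (* Strong induction on i through the bound [B]; the starting time j is arbitrary because removing
     a block moves it forward. *)
  assert (Hall : forall B i j, (i <= B)%nat -> m / 2 * q ^ i <= Cmod (Diter i (Nat.iter j f (RtoC 0)))).
  { induction B as [|B IH]; intros i j Hi.
    - replace i with 0%nat by lia. simpl. rewrite Cmod_1. specialize (Hmk 0%nat ltac:(lia)). simpl in Hmk. lra.
    - destruct (Nat.le_gt_cases i N) as [HiN|HiN].
      + apply Rle_trans with (m0 ^ i); [|apply Diter_lower, avoids_iter].
        specialize (Hmk i HiN). specialize (Hqk i HiN). nra.
      + destruct (HN j) as [n [Hn1 Hn2]].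
        replace i with (n + (i - n))%nat by lia. rewrite Diter_add, Cmod_mult, pow_add.
        rewrite <- Nat.iter_add.
        specialize (IH (i - n)%nat (n + j)%nat ltac:(lia)).
        specialize (Hqk n ltac:(lia)).
        assert (P : 0 < q ^ (i - n)) by (apply pow_lt; lra).
        apply Rle_trans with (m / 2 * q ^ (i - n) * 2).
        * replace (m / 2 * (q ^ n * q ^ (i - n))) with (m / 2 * q ^ (i - n) * q ^ n) by ring.
          apply Rmult_le_compat_l; nra.
        * apply Rmult_le_compat; try lra. nra. }
  intro n. exact (Hall n n 0%nat (le_n _)).
Qed.

End Exponential.

(** * From the postsingular set to the orbit of 0, and the two conclusions *)

Lemma postsingular_avoids (lam : C) : ~ postsingular lam (RtoC 0) ->
  exists del, 0 < del /\ avoids lam del (RtoC 0).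
Proof.
  intro H. apply NNPP. intro Hno. apply H. intros V [e HV].
  apply NNPP. intro Hn. apply Hno. exists e. split; [apply cond_pos|].
  intros n Hn1. apply Rnot_lt_le. intro Hlt. apply Hn.
  exists (Nat.iter n (flam lam) (RtoC 0)). split; [|eauto].
  apply HV. apply Cmod_ball.
  replace (Nat.iter n (flam lam) (RtoC 0) - RtoC 0)%C
    with (Nat.iter n (flam lam) (RtoC 0)) by ring. exact Hlt.
Qed.

Lemma postsingular_iter (lam : C) n : (1 <= n)%nat ->
  postsingular lam (Nat.iter n (flam lam) (RtoC 0)).
Proof.
  intros Hn V HV. exists (Nat.iter n (flam lam) (RtoC 0)). split; [|eauto].
  exact (locally_singleton _ _ HV).
Qed.

Lemma C_derive_iter (lam : C) n z : C_derive (Nat.iter n (flam lam)) z = Diter lam n z.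
Proof. apply cder_is_derive, cder_iter. Qed.

Theorem theorem3
    (lam : C) (hlam : lam <> RtoC 0)
    (hJ : forall z : C, julia (flam lam) z)
    (h0 : ~ postsingular lam (RtoC 0)) :
  (exists n : nat -> nat,
      strictly_increasing n /\
      is_lim_seq
        (fun k : nat => Cmod (C_derive (Nat.iter (n k) (flam lam)) (RtoC 1)))
        p_infty) /\
  (bounded_subset (postsingular lam) -> summable (flam lam) (RtoC 0)).
Proof.
  destruct (postsingular_avoids lam h0) as [del [Hdel Hav]].
  split.
  - assert (H1 : avoids lam del (RtoC 1)).
    { replace (RtoC 1) with (flam lam (RtoC 0)).
      - apply avoids_flam, Hav.
      - unfold flam. rewrite Cmult_0_r. apply Cexp_0. }
    assert (Htail := derivatives_unbounded_tail lam hlam del Hdel Hav hJ _ H1).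
    (* The times are chosen recursively beyond the previous one, with derivative exceeding the
       index; the value at k = 0 is arbitrary. *)
    set (n := fix n (k : nat) : nat := match k with
      | O => O
      | S k => epsilon (inhabits O)
          (fun m => (n k < m)%nat /\ INR (S k) < Cmod (Diter lam m (RtoC 1))) end).
    assert (Hn : forall k, (n k < n (S k))%nat /\ INR (S k) < Cmod (Diter lam (n (S k)) (RtoC 1))).
    { intro k. apply (epsilon_spec (inhabits O)
        (fun m => (n k < m)%nat /\ INR (S k) < Cmod (Diter lam m (RtoC 1)))).
      apply Htail. }
    exists n. split; [intro k; apply Hn|].
    apply is_lim_seq_spec. intro M.
    destruct (nfloor_ex (Rabs M)) as [N [_ HN]]; [apply Rabs_pos|].
    exists (S N). intros k Hk. rewrite C_derive_iter.
    destruct k as [|k]; [lia|].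
    apply Rlt_trans with (INR (S k)); [|apply Hn].
    apply Rle_lt_trans with (Rabs M); [apply Rle_abs|].
    apply Rlt_le_trans with (INR N + 1); auto.
    rewrite <- S_INR. apply le_INR. lia.
  - intros [M HM].
    (* [HM] speaks of the orbit from time 1 on; the absolute value also bounds the starting point
       0. *)
    destruct (exponential_growth lam hlam del Hdel Hav hJ (Rabs M)) as [c [q [Hc [Hq H]]]].
    { intros [|n].
      - simpl. rewrite Cmod_0. apply Rabs_pos.
      - eapply Rle_trans; [|apply Rle_abs]. apply HM, postsingular_iter. lia. }
    apply (ex_series_le (K := R_AbsRing) (V := R_CompleteNormedModule))
      with (fun n => / c * (/ q) ^ n).
    + intro n. rewrite C_derive_iter.
      change (Rabs (Cmod (/ Diter lam n (RtoC 0))) <= / c * (/ q) ^ n).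
      rewrite Rabs_pos_eq by apply Cmod_ge_0.
      rewrite Cmod_inv by exact (Diter_neq_0 lam hlam _ _).
      rewrite pow_inv, <- Rinv_mult.
      apply Rinv_le_contravar; auto.
      apply Rmult_lt_0_compat; auto. apply pow_lt. lra.
    + apply (ex_series_scal (/ c) (fun n => (/ q) ^ n)).
      apply ex_series_geom. rewrite Rabs_pos_eq by (left; apply Rinv_0_lt_compat; lra).
      rewrite <- Rinv_1. apply Rinv_lt_contravar; lra.
Qed.
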